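(* Let $\mathfrak{H}$ be a separable Hilbert space with an orthogonal decomposition $\mathfrak{H}=\mathfrak{H}_0\oplus\mathfrak{H}_1$, let $A_0$, $A_1$ be bounded self-adjoint operators on $\mathfrak{H}_0$, $\mathfrak{H}_1$ respectively, let $V:\mathfrak{H}_1\to\mathfrak{H}_0$ be a bounded operator, and let $\lambda\in\mathbb{R}$ satisfy $\sup\mathrm{spec}(A_0)\le\lambda\le\inf\mathrm{spec}(A_1)$. Put $$\mathbf{B}=\begin{pmatrix}A_0&V\\ V^*&A_1\end{pmatrix},\qquad \mathfrak{Q}=\mathrm{Ran}\,\mathsf{E}_{\mathbf{B}}((-\infty,\lambda))\oplus\big(\mathrm{Ran}\,\mathsf{E}_{\mathbf{B}}(\{\lambda\})\cap\mathfrak{H}_0\big).$$ Then: (i) The $\mathbf{B}$-invariant subspace $\mathfrak{Q}$ is a graph subspace, $\mathfrak{Q}=\mathcal{G}(\mathfrak{H}_0,X)$, where $X:\mathfrak{H}_0\to\mathfrak{H}_1$ is a contraction, $\|X\|\le1$, with the properties $$\mathrm{Ker}(A_0-\lambda)\cap\mathrm{Ker}\,V^*\subset\mathrm{Ker}\,X,\qquad \mathrm{Ker}(A_1-\lambda)\cap\mathrm{Ker}\,V\subset\mathrm{Ker}\,X^*.$$ (ii) If either $\mathrm{Ker}(A_0-\lambda)=\{0\}$ or $\mathrm{Ker}(A_1-\lambda)=\{0\}$, then $X$ is a strict contraction, i.e. $\|Xf\|<\|f\|$ for all $f\neq0$. (iii) If $d=\mathrm{dist}(\mathrm{spec}(A_0),\mathrm{spec}(A_1))>0$,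 then $X$ is a uniform contraction satisfying $$\|X\|\le\tan\left(\frac12\arctan\frac{2\|V\|}{d}\right)<1.$$
   Context: $\mathrm{spec}(T)$ denotes the spectrum of $T$, and $\mathsf{E}_{\mathbf{B}}(\Delta)$ the spectral projection of the self-adjoint operator $\mathbf{B}$ for the Borel set $\Delta\subset\mathbb{R}$. For an operator $X:\mathfrak{H}_0\to\mathfrak{H}_1$, its graph is $\mathcal{G}(\mathfrak{H}_0,X)=\{x\oplus Xx\mid x\in\mathfrak{H}_0\}\subset\mathfrak{H}$. Subspaces of $\mathfrak H_0$ and $\mathfrak H_1$ are regarded as subspaces of $\mathfrak{H}$ in the natural way. *)

(* Defs.v *)
From HB Require Import structures.
From mathcomp Require Import all_boot all_order all_algebra.
From mathcomp Require Import all_classical all_reals all_analysis.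
From mathcomp Require Import complex.

Set Implicit Arguments.
Unset Strict Implicit.
Unset Printing Implicit Defensive.

Import Order.TTheory GRing.Theory Num.Theory.
Import numFieldNormedType.Exports.

Local Open Scope classical_set_scope.
Local Open Scope complex_scope.
Local Open Scope ring_scope.

(* Complex Hilbert spaces.  As for every {dot _ for _}, the inner product is
   linear in its first argument and conjugate-linear in the second one. *)
HB.mixin Record CompleteNormedModule_isHilbert (R : realType) H
    of CompleteNormedModule R[i] H := {
  hilbert_inner : {dot H for (@Num.conj R[i])} ;
  hilbert_innerE : forall x : H, hilbert_inner x x = `|x| ^+ 2
}.

#[short(type="hilbertType")]
HB.structure Definition Hilbert (R : realType) :=
  {H of CompleteNormedModule R[i] H & CompleteNormedModule_isHilbert R H}.

Definition inner (R : realType) (H : hilbertType R) (x y : H) : R[i] :=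
  (@hilbert_inner R H : H -> H -> R[i]) x y.

Definition separable (T : topologicalType) : Prop :=
  exists2 D : set T, countable D & dense D.

Section Operators.
Context (R : realType).
Implicit Types F G H : hilbertType R.

Definition bounded_operator F G (T : F -> G) : Prop :=
  bounded_near T (nbhs (0 : F)).

(* Norms of vectors live in R[i] and are real there; the operator norm is
   taken in R. *)
Definition opnorm F G (T : F -> G) : R :=
  sup [set complex.Re `|T x| | x in [set x : F | `|x| <= 1]].

Definition kernel_set F G (T : F -> G) : set F := [set x | T x = 0].

Definition shift_operator H (T : H -> H) (z : R[i]) : H -> H :=
  fun x => T x - z *: x.

Definition self_adjoint H (T : H -> H) : Prop :=
  forall x y, inner (T x) y = inner x (T y).

(* The value at y is determined for bounded linear T by the Riesz
   representation theorem. *)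
Definition adjoint F G (T : F -> G) (y : G) : F :=
  get [set w : F | forall x : F, inner (T x) y = inner x w].

Definition spectrum H (T : H -> H) : set R[i] :=
  [set z | ~ exists S : {linear H -> H},
    [/\ bounded_operator S,
        forall x, S (shift_operator T z x) = x &
        forall x, shift_operator T z (S x) = x]].

(* This is the whole spectrum when T is self-adjoint. *)
Definition real_spectrum H (T : H -> H) : set R :=
  [set t | spectrum T t%:C].

(* Extended-real bounds, so that the empty spectrum of an operator on the
   zero space is covered: sup = -oo and inf = +oo. *)
Definition sup_spectrum H (T : H -> H) : \bar R :=
  ereal_sup [set t%:E | t in real_spectrum T].

Definition inf_spectrum H (T : H -> H) : \bar R :=
  ereal_inf [set t%:E | t in real_spectrum T].

Definition set_dist (S T : set R) : \bar R :=
  ereal_inf [set `|s - t|%:E | s in S & t in T].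

Definition orthogonal_projection H (P : H -> H) : Prop :=
  self_adjoint P /\ forall x, P (P x) = P x.

(* The positive measure Delta |-> <E(Delta) x, x>. *)
Definition scalar_measure H (E : set R -> {linear H -> H}) (x : H)
    (D : set R) : \bar R :=
  (complex.Re (inner (E D x) x))%:E.

(* E is the spectral measure of B: a projection-valued measure on the Borel
   sets of R with B = \int t dE(t), the integral being understood weakly. *)
Record is_spectral_measure H (B : H -> H) (E : set R -> {linear H -> H})
    : Prop := IsSpectralMeasure {
  spectral_projection : forall D, measurable D -> orthogonal_projection (E D) ;
  spectral_set0 : forall x, E set0 x = 0 ;
  spectral_setT : forall x, E setT x = x ;
  spectral_setI : forall C D, measurable C -> measurable D ->
    forall x, E (C `&` D) x = E C (E D x) ;
  spectral_bigcup : forall D : nat -> set R, (forall n, measurable (D n)) ->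
    trivIset setT D ->
    forall x, (fun n => \sum_(k < n) E (D k) x) @ \oo --> E (\bigcup_n D n) x ;
  spectral_integrable : forall x,
    (scalar_measure E x).-integrable setT (EFin : R -> \bar R) ;
  spectral_integral : forall x,
    inner (B x) x = (fine (\int[scalar_measure E x]_(t in setT) t%:E)%E)%:C
}.

(* H = H0 (+) H1, where i0 and i1 are the inclusions of the summands. *)
Record orthogonal_decomposition H H0 H1
    (i0 : {linear H0 -> H}) (i1 : {linear H1 -> H})
    : Prop := OrthogonalDecomposition {
  decomp_isom0 : forall x y, inner (i0 x) (i0 y) = inner x y ;
  decomp_isom1 : forall x y, inner (i1 x) (i1 y) = inner x y ;
  decomp_ortho : forall x y, inner (i0 x) (i1 y) = 0 ;
  decomp_total : forall z, exists x y, z = i0 x + i1 y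
}.

Section Block.
Context (H H0 H1 : hilbertType R).
Context (i0 : {linear H0 -> H}) (i1 : {linear H1 -> H}).

(* The operator matrix (A0, V ; V^*, A1); the components in H0 and H1 of a
   vector z of H are adjoint i0 z and adjoint i1 z. *)
Definition block_operator (A0 : H0 -> H0) (A1 : H1 -> H1) (V : H1 -> H0)
    (z : H) : H :=
  let x := adjoint i0 z in
  let y := adjoint i1 z in
  i0 (A0 x + V y) + i1 (adjoint V x + A1 y).

Definition graph_subspace (X : H0 -> H1) : set H :=
  [set i0 x + i1 (X x) | x in setT].

Definition subspace_sum (K L : set H) : set H :=
  [set u + v | u in K & v in L].

Definition Qsubspace (E : set R -> {linear H -> H}) (lam : R) : set H :=
  subspace_sum (range (E `]-oo, lam[%classic)) (range (E [set lam]) `&` range i0).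

End Block.
End Operators.

(* Main.v *)
Require Import Defs.
From HB Require Import structures.
From mathcomp Require Import all_boot all_order all_algebra.
From mathcomp Require Import all_classical all_reals all_analysis.
From mathcomp Require Import complex.
From mathcomp Require Import ring lra.

Set Implicit Arguments.
Unset Strict Implicit.
Unset Printing Implicit Defensive.

Import Order.TTheory GRing.Theory Num.Theory.
Import numFieldNormedType.Exports.

Local Open Scope classical_set_scope.
Local Open Scope complex_scope.
Local Open Scope ring_scope.

(** Write z = x + y along H0 and H1, and let J change the sign of y, so that
   <J z, z> = |x|^2 - |y|^2.  The off-diagonal part of B anticommutes with J, hence
   (B - lam) J + J (B - lam) is twice the diagonal operator with entries A0 - lam
   and lam - A1, which is nonpositive because the extreme points of the numerical
   range of a self-adjoint operator belong to its spectrum.  This is a Lyapunov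
   inequality for J.  On the spectral subspace of B below lam - e, where B - lam is
   bounded away from 0, it forces the form of J to be nonnegative: the infimum of
   that form is an approximate eigenvalue of the compression of J, and a negative
   one would give the Lyapunov form the wrong sign (lyapunov_nonnegative).  Letting
   e tend to 0 gives |y| <= |x| on Ran E((-oo, lam)), and by symmetry |x| <= |y| on
   Ran E((lam, +oo)).

   An eigenvector of B for lam has components annihilated by A0 - lam, V*, A1 - lam
   and V (block_eigenvector), so Ran E({lam}) is the sum of its parts in H0 and in
   H1.  Therefore the projection onto Q is E((-oo, lam)) plus the H0-part of
   E({lam}), with |y| <= |x| on Q and |x| <= |y| on its orthogonal complement.  The
   first inequality makes the projection of Q to H0 injective and the second makes
   the compression to H0 of the projection onto Q at least 1/2, hence onto: Q is the
   graph of a contraction X (Q_graph).  The kernel inclusions hold because the parts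
   of Ran E({lam}) in H0 and H1 lie in Q and in its complement.

   If |X f| = |f|, then z = f + X f is isotropic for the nonnegative form of J on Q,
   so J z is orthogonal to Q, in particular to (B - lam) z.  The Lyapunov form then
   vanishes at z, which makes f and X f eigenvectors of A0 and A1 for lam
   (Q_isotropic); both are nonzero if f is.

   For the quantitative bound let a and b be the maximum of the spectrum of A0 and
   the minimum of that of A1, so that d <= b - a.  Invariance of Q is the Riccati
   equation V* + A1 X = X (A0 + V X).  Pairing it with X x for an approximate
   maximiser x of |X x| yields (b - a) s^2 <= (1 - s^2) |V| s for s = |X|
   (riccati_norm), and 2 s / (1 - s^2) = tan (2 arctan s) turns this into the
   half-angle bound.

   The spectral measure is only given weakly, through the integrals for <B x, x>.
   That E commutes with B follows by polarization: for u in Ran E(D) and v in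
   its complement the measures of u and v add up to that of u + v, so the cross
   term of the form of B vanishes (spectral_orthogonal). *)

(** * The real inner product *)

Lemma discriminant_le (R : realType) (a b c : R) :
  0 <= a -> (forall t, 0 <= a * t ^+ 2 + 2 * b * t + c) -> b ^+ 2 <= a * c.
Proof.
rewrite le_eqVlt => /predU1P[<-|a0] h; last first.
- have := h (- b / a).
  rewrite -(ler_pM2l a0) mulr0.
  have -> : a * (a * (- b / a) ^+ 2 + 2 * b * (- b / a) + c) = a * c - b ^+ 2.
    by field; rewrite gt_eqF.
  by rewrite subr_ge0.
- rewrite mul0r; have [->|b0] := eqVneq b 0; first by rewrite expr0n.
  have := h (- (c + 1) / (2 * b)); rewrite mul0r add0r.
  have -> : 2 * b * (- (c + 1) / (2 * b)) + c = -1 by field.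
  by rewrite lerNr oppr0 ler10.
Qed.

Section RealInner.
Context (R : realType) (H : hilbertType R).
Implicit Types (x y z : H) (a : R).

(** The quadratic forms of self-adjoint operators and all norms are real, so the
   inequalities below are stated in R for the real part of the inner product,
   which is symmetric and bilinear over R. *)
Definition rip x y : R := complex.Re (inner x y).
Definition nrm x : R := complex.Re `|x|.

Lemma innerDl x y z : inner (x + y) z = inner x z + inner y z.
Proof. by rewrite /inner linearDl. Qed.

Lemma innerZl (a : R[i]) x y : inner (a *: x) y = a * inner x y.
Proof. by rewrite /inner linearZl_LR. Qed.

Lemma inner_conj x y : inner x y = (inner y x)^*%C.
Proof. by rewrite /inner hermC /= expr0 mul1r. Qed.

Lemma ripC x y : rip x y = rip y x.
Proof. by rewrite /rip inner_conj; case: (inner y x). Qed.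

Lemma ripDl x y z : rip (x + y) z = rip x z + rip y z.
Proof. by rewrite /rip innerDl raddfD. Qed.

Lemma ripZl a x y : rip (a%:C *: x) y = a * rip x y.
Proof.
by rewrite /rip innerZl; case: (inner x y) => u v /=; rewrite mul0r subr0.
Qed.

Lemma ripNl x y : rip (- x) y = - rip x y.
Proof. by rewrite -scaleN1r -(rmorphN1 (real_complex R)) ripZl mulN1r. Qed.

Lemma ripBl x y z : rip (x - y) z = rip x z - rip y z.
Proof. by rewrite ripDl ripNl. Qed.

Lemma ripDr x y z : rip z (x + y) = rip z x + rip z y.
Proof. by rewrite !(ripC z) ripDl. Qed.

Lemma ripZr a x y : rip y (a%:C *: x) = a * rip y x.
Proof. by rewrite !(ripC y) ripZl. Qed.

Lemma ripNr x y : rip y (- x) = - rip y x.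
Proof. by rewrite !(ripC y) ripNl. Qed.

Lemma ripBr x y z : rip z (x - y) = rip z x - rip z y.
Proof. by rewrite !(ripC z) ripBl. Qed.

Lemma rip0l x : rip 0 x = 0.
Proof. by rewrite -(subrr x) ripBl subrr. Qed.

Lemma rip0r x : rip x 0 = 0.
Proof. by rewrite ripC rip0l. Qed.

Definition ripE :=
  (ripDl, ripDr, ripBl, ripBr, ripNl, ripNr, ripZl, ripZr, rip0l, rip0r).

Lemma Im_inner x y : complex.Im (inner x y) = rip x ('i%C *: y).
Proof.
rewrite (ripC x) /rip innerZl (inner_conj x).
by case: (inner y x) => u v /=; rewrite mul0r mul1r sub0r.
Qed.

Lemma normE x : `|x| = (nrm x)%:C.
Proof.
have := normr_ge0 x; rewrite /nrm lecE /= => /andP[/eqP Hi _].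
by move: Hi; case: `|x| => a b /= ->.
Qed.

Lemma inner_self x : inner x x = (nrm x ^+ 2)%:C.
Proof. by rewrite /inner hilbert_innerE normE -rmorphXn. Qed.

Lemma rip_self x : rip x x = nrm x ^+ 2.
Proof. by rewrite /rip inner_self. Qed.

Lemma nrm_ge0 x : 0 <= nrm x.
Proof. by have := normr_ge0 x; rewrite normE ler0c. Qed.

Lemma nrm0_eq0 x : nrm x = 0 -> x = 0.
Proof. by move=> h; apply/normr0_eq0; rewrite normE h. Qed.

Lemma nrm0 : nrm 0 = 0.
Proof. by rewrite /nrm normr0. Qed.

Lemma nrmD x y : nrm (x + y) <= nrm x + nrm y.
Proof. by rewrite -lecR rmorphD /= -!normE ler_normD. Qed.

Lemma nrmZ a x : nrm (a%:C *: x) = `|a| * nrm x.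
Proof.
have : (nrm (a%:C *: x))%:C = (`|a| * nrm x)%:C.
  rewrite -normE normrZ normE rmorphM; congr (_ * _).
  by rewrite normc_def /= expr0n addr0 sqrtr_sqr.
by move/complexI.
Qed.

Lemma nrmN x : nrm (- x) = nrm x.
Proof. by rewrite /nrm normrN. Qed.

Lemma nrmB x y : nrm (x - y) = nrm (y - x).
Proof. by rewrite -nrmN opprB. Qed.

Lemma nrm_gt0 x : x != 0 -> 0 < nrm x.
Proof.
by move=> x0; rewrite lt_neqAle nrm_ge0 andbT eq_sym; apply: contra_neq x0 => /nrm0_eq0.
Qed.

Lemma nrm_normalise x : x != 0 -> nrm ((nrm x)^-1%:C *: x) = 1.
Proof. by move=> /nrm_gt0 h; rewrite nrmZ gtr0_norm ?invr_gt0// mulVf// gt_eqF. Qed.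

Lemma rip_eq x y : (forall z, rip x z = rip y z) -> x = y.
Proof.
move=> h; apply/eqP; rewrite -subr_eq0; apply/eqP/nrm0_eq0/eqP.
by rewrite -sqrf_eq0 -rip_self ripBl h subrr.
Qed.

Lemma nrmD_sqr x y : nrm (x + y) ^+ 2 = nrm x ^+ 2 + 2 * rip x y + nrm y ^+ 2.
Proof. by rewrite -!rip_self !ripE (ripC y x); ring. Qed.

Lemma nrmB_sqr x y : nrm (x - y) ^+ 2 = nrm x ^+ 2 - 2 * rip x y + nrm y ^+ 2.
Proof. by rewrite -!rip_self !ripE (ripC y x); ring. Qed.

(** A nonnegative symmetric form satisfies the Cauchy--Schwarz inequality: the
   quadratic polynomial of t attached to x + t y has no two real roots. *)
Lemma form_cauchy_schwarz (T : H -> H) x y : linear T -> self_adjoint T ->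
  (forall z, 0 <= rip (T z) z) ->
  rip (T x) y ^+ 2 <= rip (T x) x * rip (T y) y.
Proof.
move=> linT sT T0; rewrite mulrC; apply: discriminant_le => // t.
have := T0 (t%:C *: y + x); rewrite linT !ripE.
have -> : rip (T y) x = rip (T x) y by rewrite ripC /rip sT.
by move/le_trans; apply; rewrite le_eqVlt; apply/orP; left; apply/eqP; ring.
Qed.

Lemma cauchy_schwarz x y : `|rip x y| <= nrm x * nrm y.
Proof.
rewrite -(@ler_pXn2r _ 2) ?nnegrE ?mulr_ge0 ?nrm_ge0//.
rewrite real_normK ?num_real// exprMn -!rip_self.
by apply: (@form_cauchy_schwarz id) => // z; rewrite rip_self sqr_ge0.
Qed.

Lemma rip_le x y : rip x y <= nrm x * nrm y.
Proof. exact: le_trans (ler_norm _) (cauchy_schwarz x y). Qed.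

Lemma rip_ge x y : - (nrm x * nrm y) <= rip x y.
Proof. by rewrite lerNl -ripNl -(nrmN x) rip_le. Qed.

End RealInner.

Section RealPartOperators.
Context (R : realType).
Implicit Types F G H : hilbertType R.

(** The imaginary part of an inner product is the real part of another one, so
   complex identities reduce to two real ones. *)
Lemma inner_eq F G (x y : F) (x' y' : G) :
  rip x y = rip x' y' -> rip x ('i%C *: y) = rip x' ('i%C *: y') ->
  inner x y = inner x' y'.
Proof.
by rewrite -!Im_inner /rip; case: (inner x y) (inner x' y') => a b [c d] /= -> ->.
Qed.

Lemma self_adjoint_rip H (T : H -> H) (x y : H) :
  self_adjoint T -> rip (T x) y = rip x (T y).
Proof. by move=> sT; rewrite /rip sT. Qed.

Definition bound_by F G (T : F -> G) (K : R) := forall x, nrm (T x) <= K * nrm x.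

Lemma bounded_operatorP F G (T : {linear F -> G}) :
  bounded_operator T <-> exists2 K, 0 <= K & bound_by T K.
Proof.
split=> [/linear_boundedP /pinfty_ex_gt0 [r r0 hr]|[K K0 hK]].
  have rE : r = (complex.Re r)%:C.
    by move: r0; rewrite ltcE => /andP[/eqP + _]; case: (r) => a b /= ->.
  exists (complex.Re r); first by move: r0; rewrite ltcE => /andP[_ /ltW].
  by move=> x; have := hr x; rewrite !normE {1}rE -rmorphM lecR.
apply/linear_boundedP; near=> r => x.
have := hK x; rewrite -lecR rmorphM /= -!normE => /le_trans; apply.
apply: ler_wpM2r => //; near: r.
by apply: nbhs_pinfty_ge; apply/complex_realP; exists K.
Unshelve. all: by end_near. Qed.

End RealPartOperators.

(** * Completeness and coercive forms *)

Section Completeness.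
Context (R : realType) (H : hilbertType R).

(** Convergence in H uses the norm in R[i] and tolerances in R[i]; this is its
   formulation with tolerances in R. *)
Definition tends_to (x : nat -> H) (w : H) :=
  forall e : R, 0 < e -> exists N, forall n, (N <= n)%N -> nrm (x n - w) < e.

Lemma gt0_complexE (e : R[i]) : 0 < e -> e = (complex.Re e)%:C /\ 0 < complex.Re e.
Proof. by case: e => a b; rewrite ltcE /= => /andP[/eqP-> ?]. Qed.

Lemma cvg_tends_to (x : nat -> H) (w : H) : x @ \oo --> w <-> tends_to x w.
Proof.
split=> [/cvgrPdist_lt h e e0|h].
  have /h[N _ hN] : 0 < e%:C by rewrite ltcR.
  by exists N => n Nn; have := hN n Nn; rewrite /= normE ltcR nrmB.
apply/cvgrPdist_lt => e /gt0_complexE[eE /h[N hN]].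
by exists N => // n Nn; rewrite /= normE eE ltcR nrmB; exact: hN.
Qed.

Lemma hilbert_complete (x : nat -> H) :
  (forall e : R, 0 < e -> exists N, forall i j, (N <= i)%N -> (N <= j)%N ->
    nrm (x i - x j) < e) -> exists w, tends_to x w.
Proof.
move=> h; suff : cvg (x @ \oo) by move=> /cvg_ex[w /cvg_tends_to]; exists w.
apply/cauchy_cvgP/cauchy_exP => e /gt0_complexE[eE /h[N hN]].
exists (x N), N => // n Nn; rewrite -ball_normE /= normE eE ltcR.
exact: hN.
Qed.

End Completeness.

Lemma harmonic_small (R : realType) (e : R) : 0 < e ->
  exists N, forall n, (N <= n)%N -> n.+1%:R^-1 < e.
Proof.
by move=> e0; have [N _ hN] := near_infty_natSinv_lt (PosNum e0); exists N.
Qed.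

Section Coercive.
Context (R : realType) (H : hilbertType R).
Variables (S : {linear H -> H}) (f : H -> R) (M c : R).
Hypotheses (sS : self_adjoint S) (c0 : 0 < c).
Hypothesis S_coercive : forall x, c * nrm x ^+ 2 <= rip (S x) x.
Hypothesis fD : forall x y, f (x + y) = f x + f y.
Hypothesis fZ : forall (a : R) x, f (a%:C *: x) = a * f x.
Hypothesis bf : forall x, `|f x| <= M * nrm x.

Let energy x := rip (S x) x - 2 * f x.

Let SD x y : S (x + y) = S x + S y. Proof. exact: linearD. Qed.
Let SZ (a : R) x : S (a%:C *: x) = a%:C *: S x. Proof. exact: linearZ. Qed.
Let ripS x y : rip (S x) y = rip (S y) x.
Proof. by rewrite (self_adjoint_rip _ _ sS) ripC. Qed.

Let energyD x y (t : R) :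
  energy (x + t%:C *: y) =
  energy x + 2 * t * (rip (S x) y - f y) + t ^+ 2 * rip (S y) y.
Proof. by rewrite /energy SD SZ fD fZ !ripE (ripS y x); ring. Qed.

Let energy_ge x : - (M ^+ 2 / c) <= energy x.
Proof.
have h1 := ler_wpM2l (ltW c0) (S_coercive x).
have h2 := ler_wpM2l (ltW c0) (le_trans (ler_norm _) (bf x)).
have cM : c * (M ^+ 2 / c) = M ^+ 2 by field; rewrite gt_eqF.
rewrite /energy -(ler_pM2l c0) mulrN cM mulrBr.
have := sqr_ge0 (c * nrm x - M); lra.
Qed.

Let energy_midpoint x y :
  energy ((2^-1)%:C *: (x + y)) * 2 + 2^-1 * (c * nrm (x - y) ^+ 2)
    <= energy x + energy y.
Proof.
have := S_coercive (x - y); rewrite /energy !SZ !fZ !SD !fD linearN /= !ripE.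
rewrite (ripS y x); lra.
Qed.

(** The Riesz representation theorem is the case where S is the identity; the
   case of a functional <h, .> says that S is onto.
   The minimum of the coercive energy <Sx, x> - 2 f x exists, because the
   parallelogram law makes minimising sequences Cauchy; at the minimum the
   derivative 2 (<Sw, v> - f v) vanishes. *)
Lemma coercive_representation : exists w, forall v, rip (S w) v = f v.
Proof.
pose E := [set energy x | x in [set: H]].
have infE : has_inf E.
  split; first by exists (energy 0), 0.
  by exists (- (M ^+ 2 / c)) => _ [x _ <-]; exact: energy_ge.
pose m := inf E.
have mle x : m <= energy x by apply: ge_inf => //; [case: infE|exists x].
have /choice[x hx] (n : nat) : exists x, energy x < m + n.+1%:R^-1.
  have n0 : 0 < n.+1%:R^-1 :> R by rewrite invr_gt0.
  by have [_ [x _ <-] hx] := inf_adherent n0 infE; exists x.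
have [w xw] : exists w, tends_to x w.
  apply: hilbert_complete => e e0.
  have d0 : 0 < c * e ^+ 2 / 4 by rewrite divr_gt0 ?mulr_gt0 ?exprn_gt0.
  have [N hN] := harmonic_small d0.
  exists N => i j Ni Nj; rewrite -(@ltr_pXn2r _ 2) ?nnegrE ?nrm_ge0 ?ltW//.
  rewrite -(ltr_pM2l c0); have := energy_midpoint (x i) (x j).
  have := mle ((2^-1)%:C *: (x i + x j)); have := hx i; have := hx j.
  have := hN i Ni; have := hN j Nj.
  move: (i.+1%:R^-1) (j.+1%:R^-1) => p q; lra.
exists w => v; set s := rip (S v) v.
have s0 : 0 <= s by apply: le_trans (S_coercive v); rewrite mulr_ge0 ?sqr_ge0 ?ltW.
suff h (t : R) : 0 <= s * t ^+ 2 + 2 * (rip (S w) v - f v) * t + 0.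
  have := discriminant_le s0 h; rewrite mulr0 => g0.
  by apply/eqP; rewrite -subr_eq0 -sqrf_eq0 eq_le g0 sqr_ge0.
(* Compare the energies at x n and at x n + t v, for n large. *)
apply/ler_addgt0Pr => e e0; have e20 : 0 < e / 2 by rewrite divr_gt0.
pose C := 2 * `|t| * nrm (S v).
have C0 : 0 <= C by rewrite !mulr_ge0 ?nrm_ge0.
have d0 : 0 < e / 2 / (1 + C) by rewrite divr_gt0// ltr_wpDr.
have [N1 hN1] := harmonic_small e20.
have [N2 hN2] := xw _ d0.
pose n := maxn N1 N2.
have h1 := hN1 n (leq_maxl _ _); have h2 := hN2 n (leq_maxr _ _).
have h3 := mle (x n + t%:C *: v); rewrite energyD in h3.
have h4 : 2 * t * (rip (S (x n)) v - rip (S w) v) <= e / 2.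
  rewrite (ripS _ v) (ripS w) -ripBr; apply: le_trans (ler_norm _) _.
  rewrite !normrM (ger0_norm (ler0n _ 2)).
  apply: (@le_trans _ _ (C * nrm (x n - w))).
    by rewrite /C -[leRHS]mulrA ler_wpM2l ?mulr_ge0 ?cauchy_schwarz.
  move: h2; rewrite ltr_pdivlMr ?ltr_wpDr// => h2.
  have := nrm_ge0 (x n - w); lra.
by have := hx n; move: h1 h3; rewrite -/s; move: (n.+1%:R^-1) => p; lra.
Qed.

End Coercive.

(** * Adjoints *)

Section Adjoints.
Context (R : realType).
Implicit Types F G : hilbertType R.

Lemma ripi G (x y : G) : rip ('i%C *: x) y = - rip x ('i%C *: y).
Proof.
rewrite -Im_inner /rip innerZl.
by case: (inner x y) => a b /=; rewrite mul0r mul1r sub0r.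
Qed.

Lemma adjoint_unique F G (T : F -> G) y w :
  (forall x, inner (T x) y = inner x w) -> adjoint T y = w.
Proof.
move=> hw; apply: rip_eq => z.
pose P := [set w | forall x, inner (T x) y = inner x w].
have := getPex (P := P) (ex_intro _ w hw) z.
by rewrite hw !(ripC _ z) /rip -/(adjoint T y) => ->.
Qed.

(** Complex linearity of T recovers the imaginary part from the real one. *)
Lemma rip_adjoint_inner F G (T : {linear F -> G}) y w :
  (forall x, rip (T x) y = rip x w) -> forall x, inner (T x) y = inner x w.
Proof.
move=> h x; apply: inner_eq => //.
by apply: oppr_inj; rewrite -!ripi -linearZ h.
Qed.

Lemma adjoint_rip_unique F G (T : {linear F -> G}) y w :
  (forall x, rip (T x) y = rip x w) -> adjoint T y = w.
Proof. by move=> /rip_adjoint_inner; exact: adjoint_unique. Qed.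

Lemma adjointP F G (T : {linear F -> G}) : bounded_operator T ->
  forall x y, rip (T x) y = rip x (adjoint T y).
Proof.
move=> /bounded_operatorP[K K0 bT] x y.
have [w hw] : exists w, forall v, rip (idfun w) v = rip (T v) y.
  apply: (@coercive_representation _ _ idfun _ (K * nrm y) 1) => //.
  - by move=> z; rewrite rip_self mul1r.
  - by move=> u v; rewrite linearD ripDl.
  - by move=> a u; rewrite linearZ ripZl.
  - move=> u; apply: le_trans (cauchy_schwarz _ _) _.
    by rewrite mulrAC ler_wpM2r ?nrm_ge0.
by rewrite (@adjoint_rip_unique _ _ T y w) => [|z]; rewrite -hw ripC.
Qed.

Lemma adjoint_linear F G (T : {linear F -> G}) :
  bounded_operator T -> linear (adjoint T).
Proof.
move=> bT a u v; apply: adjoint_unique => x.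
have h y := rip_adjoint_inner (fun x => adjointP bT x y).
rewrite !(inner_conj _ (_ + _)) !innerDl !innerZl !(rmorphD, rmorphM) /=.
by rewrite -!inner_conj !h.
Qed.

Lemma adjoint_bound F G (T : {linear F -> G}) K : 0 <= K ->
  bound_by T K -> bounded_operator T -> bound_by (adjoint T) K.
Proof.
move=> K0 bK bT y; have [y0|y0] := eqVneq (nrm (adjoint T y)) 0.
  by rewrite y0 mulr_ge0 ?nrm_ge0.
have yp : 0 < nrm (adjoint T y) by rewrite lt_neqAle eq_sym y0 nrm_ge0.
rewrite -(ler_pM2r yp) -expr2 -rip_self -(adjointP bT).
by apply: le_trans (rip_le _ _) _; rewrite mulrAC ler_wpM2r ?nrm_ge0.
Qed.

(** Operators given by a formula are bundled existentially; only their values are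
   ever used. *)
Lemma ex_linear F G (f : F -> G) :
  linear f -> exists g : {linear F -> G}, forall x, g x = f x.
Proof.
move=> linf; pose m := GRing.isLinear.Build _ _ _ _ f linf.
pose g : {linear F -> G} := HB.pack f m.
by exists g.
Qed.

Lemma rip_self_adjoint G (T : G -> G) : linear T ->
  (forall x y, rip (T x) y = rip x (T y)) -> self_adjoint T.
Proof.
move=> /ex_linear[g gE] h x y; rewrite -!gE.
by apply: (@rip_adjoint_inner _ _ g) => z; rewrite !gE h.
Qed.

Lemma opp_operator G (T : {linear G -> G}) : bounded_operator T -> self_adjoint T ->
  exists N : {linear G -> G},
    [/\ forall x, N x = - T x, bounded_operator N & self_adjoint N].
Proof.
move=> /bounded_operatorP[K K0 bT] sT.
have [N NE] : exists N : {linear G -> G}, forall x, N x = - T x.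
  by apply: ex_linear => a u v; rewrite linearP opprD scalerN.
exists N; split=> //.
- by apply/bounded_operatorP; exists K => // x; rewrite NE nrmN; exact: bT.
- apply: rip_self_adjoint; first exact: linearP.
  by move=> x y; rewrite !NE !ripE (self_adjoint_rip _ _ sT).
Qed.

End Adjoints.

(** * Numerical range and spectrum *)

Section SpectralBounds.
Context (R : realType) (H : hilbertType R).

(** Cauchy--Schwarz for the form of T, applied to x and T x. *)
Lemma positive_form_norm (T : H -> H) K x : linear T -> self_adjoint T ->
  bound_by T K -> (forall z, 0 <= rip (T z) z) ->
  nrm (T x) ^+ 2 <= K * rip (T x) x.
Proof.
move=> linT sT bT T0; have [->|n0] := eqVneq (nrm (T x)) 0.
  have K0 : (forall z : H, nrm z = 0) \/ 0 <= K.
    have [|/existsNP[z /eqP z0]] := pselect (forall z : H, nrm z = 0); [by left|right].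
    have zp : 0 < nrm z by rewrite lt_neqAle eq_sym z0 nrm_ge0.
    by rewrite -(pmulr_lge0 _ zp); apply: le_trans (bT z); exact: nrm_ge0.
  rewrite expr0n /=; case: K0 => [h|K0]; last by rewrite mulr_ge0.
  by rewrite (nrm0_eq0 (h x)) rip0r mulr0.
have np : 0 < nrm (T x) ^+ 2 by rewrite exprn_even_gt0.
have := form_cauchy_schwarz x (T x) linT sT T0; rewrite rip_self.
have h : rip (T (T x)) (T x) <= K * nrm (T x) ^+ 2.
  apply: le_trans (rip_le _ _) _; rewrite expr2 mulrA.
  by rewrite ler_wpM2r ?nrm_ge0.
move=> h2; rewrite -(ler_pM2r np) -expr2 (le_trans h2)//.
rewrite (mulrC K) -mulrA; exact: ler_wpM2l.
Qed.

Lemma linear_subZ (T : {linear H -> H}) (c : R) : linear (fun x => T x - c%:C *: x).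
Proof.
move=> a u v; rewrite linearP scalerDr !scalerBr !scalerA (mulrC c%:C).
by rewrite opprD addrACA.
Qed.

Lemma shifted_form_norm (T : {linear H -> H}) K c x :
  bound_by T K -> self_adjoint T -> (forall z, c * nrm z ^+ 2 <= rip (T z) z) ->
  nrm (T x - c%:C *: x) ^+ 2 <= (K + `|c|) * (rip (T x) x - c * nrm x ^+ 2).
Proof.
move=> bT sT Tc; rewrite -(rip_self x) -ripZl -ripBl.
apply: (positive_form_norm (T := fun x => T x - c%:C *: x)).
- exact: linear_subZ.
- apply: rip_self_adjoint; first exact: linear_subZ.
  by move=> u v; rewrite !ripE (self_adjoint_rip _ _ sT).
- move=> z; apply: le_trans (nrmD _ _) _.
  by rewrite nrmN nrmZ mulrDl lerD2r; exact: bT.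
- by move=> z; rewrite !ripE rip_self subr_ge0.
Qed.

(** The infimum c of the numerical range is an approximate eigenvalue: the form of
   C - c is nonnegative, so it controls the norm of (C - c) x, and it is small at
   near minimisers. *)
Lemma approximate_minimiser (C : {linear H -> H}) (x0 : H) :
  bounded_operator C -> self_adjoint C -> x0 != 0 ->
  exists c, (forall x, c * nrm x ^+ 2 <= rip (C x) x) /\
    forall e, 0 < e -> exists x, nrm x = 1 /\ nrm (C x - c%:C *: x) < e.
Proof.
move=> /bounded_operatorP[K K0 bC] sC x00.
pose W := [set rip (C x) x | x in [set x | nrm x = 1]].
have infW : has_inf W.
  split.
    pose u := (nrm x0)^-1%:C *: x0.
    by exists (rip (C u) u), u => //=; exact: nrm_normalise.
  exists (- K) => _ [x /= x1 <-]; apply: le_trans (rip_ge _ _).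
  by rewrite lerN2 x1 mulr1; have := bC x; rewrite x1 mulr1.
pose c := inf W; exists c.
have cle x : c * nrm x ^+ 2 <= rip (C x) x.
  have [->|x1] := eqVneq x 0; first by rewrite nrm0 rip0r expr0n mulr0.
  have xp := nrm_gt0 x1; pose u := (nrm x)^-1%:C *: x.
  have : c <= rip (C u) u.
    by apply: ge_inf; [case: infW|exists u => //=; exact: nrm_normalise].
  rewrite /u linearZ /= !ripE mulrA -expr2 => h.
  by rewrite -ler_pdivlMr ?exprn_gt0// mulrC -exprVn.
split=> // e e0.
have L0 : 0 < K + `|c| + 1 by rewrite ltr_wpDl// addr_ge0.
have d0 : 0 < e ^+ 2 / (K + `|c| + 1) by rewrite divr_gt0 ?exprn_gt0.
have [_ [x /= x1 <-] hx] := inf_adherent d0 infW.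
exists x; split=> //; rewrite -(@ltr_pXn2r _ 2) ?nnegrE ?nrm_ge0 ?ltW//.
apply: le_lt_trans (shifted_form_norm x bC sC cle) _; rewrite x1 expr1n mulr1.
have : rip (C x) x - c < e ^+ 2 / (K + `|c| + 1) by rewrite ltrBlDl.
rewrite ltr_pdivlMr// mulrC => /(le_lt_trans _); apply.
rewrite ler_wpM2r ?lerDl//.
by have := cle x; rewrite x1 expr1n mulr1 subr_ge0.
Qed.

(** A nonnegative form controls the norm of T - c, so a unit vector that attains the
   infimum of the numerical range is an eigenvector. *)
Lemma eigenvector_form_min (T : {linear H -> H}) c x :
  bounded_operator T -> self_adjoint T ->
  (forall z, c * nrm z ^+ 2 <= rip (T z) z) -> rip (T x) x = c * nrm x ^+ 2 ->
  T x = c%:C *: x.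
Proof.
move=> /bounded_operatorP[K K0 bT] sT Tc Tx.
have := shifted_form_norm x bT sT Tc; rewrite Tx subrr mulr0 => h.
apply/eqP; rewrite -subr_eq0; apply/eqP/nrm0_eq0/eqP.
by rewrite -sqrf_eq0 eq_le h sqr_ge0.
Qed.

Lemma eigenvector_form_max (T : {linear H -> H}) c x :
  bounded_operator T -> self_adjoint T ->
  (forall z, rip (T z) z <= c * nrm z ^+ 2) -> rip (T x) x = c * nrm x ^+ 2 ->
  T x = c%:C *: x.
Proof.
move=> bT sT Tc Tx; have [N [NE bN sN]] := opp_operator bT sT.
have : N x = (- c)%:C *: x.
  apply: eigenvector_form_min => // [z|]; rewrite NE ripNl mulNr ?Tx//.
  by rewrite lerN2.
by rewrite NE rmorphN /= scaleNr => /oppr_inj.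
Qed.

(** A bounded inverse of A - c would send the small vectors (A - c) x back to the
   unit vectors x. *)
Lemma real_spectrum_approximate (A : H -> H) c :
  (forall e, 0 < e -> exists x, nrm x = 1 /\ nrm (A x - c%:C *: x) < e) ->
  real_spectrum A c.
Proof.
move=> h [S [/bounded_operatorP[K K0 bS] hS _]].
have e0 : 0 < (K + 1)^-1 by rewrite invr_gt0 ltr_wpDl.
have [x [x1 hx]] := h _ e0.
have := bS (shift_operator A c%:C x); rewrite hS x1 /shift_operator => h1.
move: hx; rewrite -[_^-1]mul1r ltr_pdivlMr ?ltr_wpDl// => h2.
have := nrm_ge0 (A x - c%:C *: x); lra.
Qed.

Lemma lower_bound_in_spectrum (A : {linear H -> H}) (x0 : H) :
  bounded_operator A -> self_adjoint A -> x0 != 0 ->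
  exists2 c, real_spectrum A c & forall x, c * nrm x ^+ 2 <= rip (A x) x.
Proof.
move=> bA sA /(approximate_minimiser bA sA)[c [hc /real_spectrum_approximate]].
by exists c.
Qed.

Lemma upper_bound_in_spectrum (A : {linear H -> H}) (x0 : H) :
  bounded_operator A -> self_adjoint A -> x0 != 0 ->
  exists2 c, real_spectrum A c & forall x, rip (A x) x <= c * nrm x ^+ 2.
Proof.
move=> bA sA x00.
have [C [CE bC sC]] := opp_operator bA sA.
have [c [hc ha]] := approximate_minimiser bC sC x00.
exists (- c); last by move=> x; have := hc x; rewrite CE ripNl mulNr lerNr.
apply: real_spectrum_approximate => e /ha[x [x1 hx]].
by exists x; split=> //; rewrite rmorphN /= scaleNr opprK -nrmN opprD -CE.
Qed.

Lemma le_inf_spectrum (A : {linear H -> H}) (lam : R) :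
  bounded_operator A -> self_adjoint A -> (lam%:E <= inf_spectrum A)%E ->
  forall x, lam * nrm x ^+ 2 <= rip (A x) x.
Proof.
move=> bA sA hlam x; have [->|x0] := eqVneq x 0.
  by rewrite nrm0 rip0r expr0n mulr0.
have [c Ac hc] := lower_bound_in_spectrum bA sA x0.
apply: le_trans (hc x); apply: ler_wpM2r; first exact: sqr_ge0.
by rewrite -lee_fin; apply: le_trans hlam _; apply: ereal_inf_lbound; exists c.
Qed.

Lemma sup_spectrum_le (A : {linear H -> H}) (lam : R) :
  bounded_operator A -> self_adjoint A -> (sup_spectrum A <= lam%:E)%E ->
  forall x, rip (A x) x <= lam * nrm x ^+ 2.
Proof.
move=> bA sA hlam x; have [->|x0] := eqVneq x 0.
  by rewrite nrm0 rip0r expr0n mulr0.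
have [c Ac hc] := upper_bound_in_spectrum bA sA x0.
apply: le_trans (hc x) _; apply: ler_wpM2r; first exact: sqr_ge0.
by rewrite -lee_fin; apply: le_trans hlam; apply: ereal_sup_ubound; exists c.
Qed.

End SpectralBounds.

(** * The spectral measure of a self-adjoint operator *)

Section RawIntegral.
Context d (T : measurableType d) (R : realType).

Import HBNNSimple.

(** The integral only sees the values on measurable sets, even for a set
   function that is not known to be a measure. *)
Lemma eq_raw_integral (m1 m2 : set T -> \bar R) (f : T -> \bar R) :
  (forall A, measurable A -> m1 A = m2 A) -> (\int[m1]_t f t = \int[m2]_t f t)%E.
Proof.
move=> m12; have h (g : {nnsfun T >-> R}) : sintegral m1 g = sintegral m2 g.
  by apply: eq_fsbigr => r _; rewrite m12.
rewrite /integral; congr (ereal_sup _ - ereal_sup _)%E.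
- by apply: eq_imagel => g _; exact: h.
- by apply: eq_imagel => g _; exact: h.
Qed.

End RawIntegral.

Section SpectralMeasure.
Context (R : realType) (H : hilbertType R).
Variables (B : H -> H) (E : set R -> {linear H -> H}).
Hypotheses (linB : linear B) (sB : self_adjoint B).
Hypothesis hE : is_spectral_measure B E.
Implicit Types (x y u v : H) (C D : set R).

Let rip_sum n (F : 'I_n -> H) y : rip (\sum_(k < n) F k) y = \sum_(k < n) rip (F k) y.
Proof.
by elim/big_rec2: _ => [|i a b _ <-]; rewrite ?rip0l ?ripDl.
Qed.

Lemma spectral_proj D x : measurable D -> E D (E D x) = E D x.
Proof. by move=> mD; have [_ ->] := spectral_projection hE mD. Qed.

Lemma spectral_rip D x y : measurable D -> rip (E D x) y = rip x (E D y).
Proof. by move=> /(spectral_projection hE)[sE _]; rewrite (self_adjoint_rip _ _ sE). Qed.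

Lemma spectral_norm D x : measurable D -> rip (E D x) x = nrm (E D x) ^+ 2.
Proof. by move=> mD; rewrite -rip_self ripC spectral_rip// spectral_proj. Qed.

Lemma spectral_disjoint C D x : measurable C -> measurable D ->
  C `&` D = set0 -> E C (E D x) = 0.
Proof. by move=> mC mD CD; rewrite -(spectral_setI hE)// CD (spectral_set0 hE). Qed.

Lemma spectral_sub C D x : measurable C -> measurable D -> C `<=` D ->
  E C (E D x) = E C x.
Proof. by move=> mC mD CD; rewrite -(spectral_setI hE)// setIidl. Qed.

Lemma spectral_setU C D x : measurable C -> measurable D -> C `&` D = set0 ->
  E (C `|` D) x = E C x + E D x.
Proof.
move=> mC mD CD.
have mb n : measurable (bigcup2 C D n) by case: n => [//|[//|n]]; exact: measurable0.
have tb : trivIset setT (bigcup2 C D) by rewrite -trivIset_bigcup2.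
have := @spectral_bigcup _ _ _ _ hE _ mb tb x; rewrite bigcup2E => /cvg_tends_to h.
apply/eqP; rewrite eq_sym -subr_eq0; apply/eqP/nrm0_eq0/eqP.
rewrite eq_le nrm_ge0 andbT; apply/ler_addgt0Pr => e e0; rewrite add0r.
have [N hN] := h e e0; have := hN N.+2 (leqW (leqnSn N)).
rewrite !big_ord_recl /= big1 ?addr0; first by move/ltW.
by move=> i _; exact: (spectral_set0 hE).
Qed.

(** E is unconstrained on non-measurable sets, where the scalar measure may even be
   negative; it is replaced by 0 there. *)
Lemma spectral_measure_ex x : exists m : {measure set R -> \bar R},
  forall D, measurable D -> m D = (rip (E D x) x)%:E.
Proof.
pose f (D : set R) : \bar R := if `[< measurable D >] then (rip (E D x) x)%:E else 0%E.
have f0 : f set0 = 0%E.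
  by rewrite /f; case: asboolP => // _; rewrite (spectral_set0 hE) rip0l.
have fge0 D : (0 <= f D)%E.
  by rewrite /f; case: asboolP => // mD; rewrite lee_fin spectral_norm// sqr_ge0.
have fs : semi_sigma_additive f.
  move=> F mF tF mU; rewrite /f; case: asboolP => // _.
  have /cvg_tends_to h := @spectral_bigcup _ _ _ _ hE _ mF tF x.
  have -> : (fun n => (\sum_(0 <= i < n) f (F i))%E) =
      EFin \o (fun n => rip (\sum_(k < n) E (F k) x) x).
    apply/funext => n /=; rewrite big_mkord rip_sum -sumEFin.
    by apply: eq_bigr => i _; rewrite /f; case: asboolP.
  apply: cvg_EFin; first exact: nearW.
  apply/cvgrPdist_lt => e e0.
  have d0 : 0 < e / (nrm x + 1) by rewrite divr_gt0 ?ltr_wpDl ?nrm_ge0.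
  have [N hN] := h _ d0; exists N => // n /hN.
  rewrite ltr_pdivlMr ?ltr_wpDl ?nrm_ge0// => hn.
  rewrite distrC -ripBl (le_lt_trans (cauchy_schwarz _ _))// (le_lt_trans _ hn)//.
  by rewrite ler_wpM2l ?nrm_ge0// lerDl.
pose m : {measure set R -> \bar R} := HB.pack f (isMeasure.Build _ _ _ f f0 fge0 fs).
by exists m => D mD; rewrite /m /= /f; case: asboolP.
Qed.

Lemma spectral_form x (m : {measure set R -> \bar R}) :
  (forall D, measurable D -> m D = (rip (E D x) x)%:E) ->
  m.-integrable setT (EFin : R -> \bar R) /\ (\int[m]_t t%:E = (rip (B x) x)%:E)%E.
Proof.
move=> mE.
have eqm f : (\int[m]_t f t = \int[scalar_measure E x]_t f t)%E.
  by apply: eq_raw_integral => D mD; rewrite mE.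
have im : m.-integrable setT (EFin : R -> \bar R).
  have /integrableP[mf fi] := spectral_integrable hE x.
  by apply/integrableP; split=> //; rewrite eqm.
split=> //; rewrite /rip (spectral_integral hE) /= -eqm fineK//.
exact: integrable_fin_num.
Qed.

(** The measures of u in Ran E(D) and v in its complement add up to the measure
   of u + v, and so do the forms of B; the cross term of B vanishes. *)
Lemma spectral_orthogonal D u v : measurable D ->
  rip (B (E D u)) (E (~` D) v) = 0.
Proof.
move=> mD; have mC := measurableC mD.
set u' := E D u; set v' := E (~` D) v.
have [mu muE] := spectral_measure_ex u'; have [mv mvE] := spectral_measure_ex v'.
have [iu Iu] := spectral_form muE; have [iv Iv] := spectral_form mvE.
have uvE S : measurable S -> measure_add mu mv S = (rip (E S (u' + v')) (u' + v'))%:E.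
  move=> mS; rewrite measure_addE muE// mvE// -EFinD; congr EFin.
  have h0 a b : rip (E S (E D a)) (E (~` D) b) = 0.
    rewrite -(spectral_setI hE)// setIC (spectral_setI hE)// spectral_rip//.
    by rewrite spectral_disjoint ?setICr ?rip0r.
  rewrite linearD !ripE h0 (ripC (E S v') u') -(spectral_rip u')// h0; lra.
have [_] := spectral_form uvE.
rewrite integral_measure_add// Iu Iv -EFinD => -[].
have BD : B (u' + v') = B u' + B v' by rewrite -[in LHS](scale1r u') linB scale1r.
rewrite BD !ripE (self_adjoint_rip v' u' sB) (ripC v' (B u')); lra.
Qed.

Lemma spectral_split D x : measurable D -> x = E D x + E (~` D) x.
Proof.
move=> mD; rewrite -spectral_setU ?setICr ?setUv ?(spectral_setT hE)//.
exact: measurableC.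
Qed.

(** By the orthogonality relation B maps Ran E(D) into itself, and the same holds for
   the complement of D. *)
Lemma spectral_commute D x : measurable D -> B (E D x) = E D (B x).
Proof.
move=> mD; apply: rip_eq => y.
have h a b : rip (B (E (~` D) a)) (E D b) = 0.
  rewrite -{2}(setCK D) spectral_orthogonal//; exact: measurableC.
have BD a b : B (a + b) = B a + B b by rewrite -[in LHS](scale1r a) linB scale1r.
rewrite {1}(spectral_split y mD) ripDr spectral_orthogonal// addr0.
by rewrite spectral_rip// {2}(spectral_split x mD) BD ripDl h addr0.
Qed.

(** The measure of E(D) u is carried by D, so bounds on t over D are bounds for the
   form of B on Ran E(D). *)
Lemma spectral_form_range D u : measurable D -> exists m : {measure set R -> \bar R},
  [/\ m.-integrable D (EFin : R -> \bar R),
      forall c : R, m.-integrable D (EFin \o cst c),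
      (\int[m]_(t in D) t%:E = (rip (B (E D u)) (E D u))%:E)%E &
      forall c : R, (\int[m]_(t in D) c%:E = (c * nrm (E D u) ^+ 2)%:E)%E].
Proof.
move=> mD; have mC := measurableC mD.
have [m mE] := spectral_measure_ex (E D u); have [im Im] := spectral_form mE.
have m0 : m (~` D) = 0%E by rewrite mE// spectral_disjoint ?rip0l// setICl.
have mDE : m D = (nrm (E D u) ^+ 2)%:E by rewrite mE// spectral_proj// rip_self.
exists m; split.
- exact: integrableS im.
- move=> c; apply: measurable_bounded_integrable => //; first by rewrite mDE ltry.
  exact: bounded_cst.
- by rewrite -Im [RHS](negligible_integral mC)// setTD setCK.
- by move=> c; rewrite EFinM -mDE -integral_cst.
Qed.

Lemma spectral_form_le D c u : measurable D -> (forall t, D t -> t <= c) ->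
  rip (B (E D u)) (E D u) <= c * nrm (E D u) ^+ 2.
Proof.
move=> mD Dc; have [m [im ic Im Ic]] := spectral_form_range u mD.
rewrite -lee_fin -Im -Ic; apply: le_integral; [exact: mD|exact: im|exact: ic|move=> t].
by rewrite inE lee_fin; exact: Dc.
Qed.

Lemma spectral_form_ge D c u : measurable D -> (forall t, D t -> c <= t) ->
  c * nrm (E D u) ^+ 2 <= rip (B (E D u)) (E D u).
Proof.
move=> mD Dc; have [m [im ic Im Ic]] := spectral_form_range u mD.
rewrite -lee_fin -Im -Ic; apply: le_integral; [exact: mD|exact: ic|exact: im|move=> t].
by rewrite inE lee_fin; exact: Dc.
Qed.

(** On the range of E({c}) the form of B - c vanishes; by polarization, and because
   B commutes with E({c}), so does B - c itself. *)
Lemma spectral_atom c u : B (E [set c] u) = c%:C *: E [set c] u.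
Proof.
have mc : measurable [set c] by exact: measurable_set1.
have BD a b : B (a + b) = B a + B b by rewrite -[in LHS](scale1r a) linB scale1r.
have q v : rip (B (E [set c] v)) (E [set c] v) = c * nrm (E [set c] v) ^+ 2.
  by apply/eqP; rewrite eq_le spectral_form_le ?spectral_form_ge// => t ->.
apply: rip_eq => y; rewrite spectral_commute// spectral_rip//.
rewrite -{1}(spectral_proj _ mc) -spectral_rip// -spectral_commute//.
have := q (u + y); rewrite linearD BD -!rip_self !ripE.
have := q u; have := q y; rewrite -!rip_self.
rewrite (self_adjoint_rip (E _ y) (E _ u) sB) (ripC (E _ y) (B _)).
rewrite (ripC (E _ y) (E _ u)) -(spectral_rip (E _ u) y)// spectral_proj//; lra.
Qed.

Lemma spectral_exhaust (F : nat -> set R) x :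
  (forall n, measurable (F n)) -> nondecreasing_seq F ->
  tends_to (fun n => E (F n) x) (E (\bigcup_n F n) x).
Proof.
move=> mF ndF; have mU : measurable (\bigcup_n F n) by exact: bigcup_measurable.
have [m mE] := spectral_measure_ex x.
have := nondecreasing_cvg_mu (mu := m) mF mU ndF.
rewrite mE// => /fine_cvgP[_] /cvgrPdist_lt h e e0.
have [N _ hN] := h _ (exprn_gt0 2 e0).
exists N => n /hN; rewrite /= !mE//= => hn.
(* By Pythagoras the squared distance is the measure of the difference set. *)
rewrite -(@ltr_pXn2r _ 2) ?nnegrE ?nrm_ge0 ?ltW//; apply: le_lt_trans hn.
apply: le_trans (ler_norm _).
rewrite !spectral_norm// nrmB_sqr spectral_rip// spectral_sub//; last first.
  exact: bigcup_sup.
by rewrite ripC spectral_norm//; lra.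
Qed.

Lemma spectral_below_exhaust c x :
  tends_to (fun n => E `]-oo, c - n.+1%:R^-1]%classic x) (E `]-oo, c[%classic x).
Proof.
have -> : `]-oo, c[%classic = \bigcup_n `]-oo, c - n.+1%:R^-1]%classic :> set R.
  apply/seteqP; split=> t; last first.
    move=> [n _]; rewrite /= !in_itv/= => /le_lt_trans; apply.
    by rewrite ltrBlDr ltrDl.
  rewrite /= in_itv /= => tc; have ct : 0 < c - t by rewrite subr_gt0.
  have [N hN] := harmonic_small ct; exists N => //=; rewrite in_itv/=.
  by have := hN _ (leqnn N); move: (N.+1%:R^-1) => p; lra.
apply: spectral_exhaust => // m n mn; apply/subsetPset => t.
rewrite /= !in_itv/= => /le_trans; apply.
by rewrite lerD2l lerN2 lef_pV2 ?posrE// ler_nat.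
Qed.

Lemma spectral_above_exhaust c x :
  tends_to (fun n => E `[c + n.+1%:R^-1, +oo[%classic x) (E `]c, +oo[%classic x).
Proof.
rewrite itvoyEbigcup.
apply: spectral_exhaust => // m n mn; apply/subsetPset => t.
rewrite /= !in_itv/= !andbT; apply: le_trans.
by rewrite lerD2l lef_pV2 ?posrE// ler_nat.
Qed.

Lemma tends_to_const0 (x : nat -> H) w : (forall n, x n = 0) -> tends_to x w -> w = 0.
Proof.
move=> x0 h; apply/nrm0_eq0/eqP; rewrite eq_le nrm_ge0 andbT.
apply/ler_addgt0Pr => e /h[N hN]; have := hN N (leqnn _).
by rewrite x0 sub0r nrmN add0r => /ltW.
Qed.

Lemma spectral_trichotomy c x :
  x = E `]-oo, c[%classic x + E [set c] x + E `]c, +oo[%classic x.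
Proof.
rewrite -spectral_setU//; last first.
  by apply/seteqP; split=> // t [] /=; rewrite in_itv/= => /[swap] ->; rewrite ltxx.
rewrite -spectral_setU//; last 2 first.
- exact: measurableU.
- apply/seteqP; split=> // t [/= + h2]; move: h2; rewrite !in_itv/= andbT.
  by move=> h2 [/(lt_trans h2)|tc]; [|move: h2; rewrite tc]; rewrite ltxx.
rewrite (_ : _ `|` _ = setT) ?(spectral_setT hE)//.
apply/seteqP; split=> // t _ /=; rewrite !in_itv/= andbT.
by have [||->] := ltgtP t c; [left; left|right|left; right].
Qed.

(** An eigenvector has no component in a part of the spectrum at positive
   distance from the eigenvalue, since there the form of B - c is definite. *)
Lemma spectral_eigenvector c x : B x = c%:C *: x -> E [set c] x = x.
Proof.
move=> Bx.
have h D (d : R) : measurable D -> 0 < d ->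
    (forall t, D t -> t <= c - d) \/ (forall t, D t -> c + d <= t) -> E D x = 0.
  move=> mD d0 hD; have BE : rip (B (E D x)) (E D x) = c * nrm (E D x) ^+ 2.
    by rewrite spectral_commute// Bx linearZ ripZl rip_self.
  apply: nrm0_eq0; apply/eqP; rewrite -sqrf_eq0 eq_le sqr_ge0 andbT -(pmulr_rle0 _ d0).
  case: hD => hD.
    by have := spectral_form_le x mD hD; rewrite BE; lra.
  by have := spectral_form_ge x mD hD; rewrite BE; lra.
have i0 n : 0 < n.+1%:R^-1 :> R by rewrite invr_gt0.
rewrite [RHS](spectral_trichotomy c).
rewrite (tends_to_const0 _ (spectral_below_exhaust c x)); last first.
  by move=> n; apply: (h _ _ _ (i0 n)) => //; left=> t; rewrite /= in_itv.
rewrite (tends_to_const0 _ (spectral_above_exhaust c x)) ?add0r ?addr0//.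
by move=> n; apply: (h _ _ _ (i0 n)) => //; right=> t; rewrite /= in_itv/= andbT.
Qed.

End SpectralMeasure.

(** * Signs of quadratic forms *)

Section FormInequalities.
Context (R : realType) (H : hilbertType R).

Lemma form_ge0_limit (T : {linear H -> H}) (x : nat -> H) w :
  bounded_operator T -> tends_to x w -> (forall n, 0 <= rip (T (x n)) (x n)) ->
  0 <= rip (T w) w.
Proof.
move=> /bounded_operatorP[K K0 bT] xw h; rewrite leNgt; apply/negP => lt0.
(* A tolerance for which the form at x n would be negative too. *)
pose C := K * (2 * nrm w + 1) + 1.
have C0 : 0 < C by rewrite ltr_wpDl// mulr_ge0// addr_ge0// mulr_ge0 ?nrm_ge0.
have e0 : 0 < Num.min 1 (- rip (T w) w / C).
  by rewrite lt_min ltr01 divr_gt0 ?oppr_gt0.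
have [n hn] := xw _ e0; have {hn} := hn n (leqnn n).
rewrite lt_min ltr_pdivlMr// => /andP[d1 dC].
have xE : x n = w + (x n - w) by rewrite addrC subrK.
move: (x n - w) xE d1 dC => d xE d1 dC.
have := h n; rewrite xE linearD !ripE.
have n0 : 0 <= nrm d by exact: nrm_ge0.
have w0 : 0 <= nrm w by exact: nrm_ge0.
have h1 : rip (T w) d <= K * nrm w * nrm d.
  by apply: le_trans (rip_le _ _) _; rewrite ler_wpM2r.
have h2 : rip (T d) w <= K * nrm d * nrm w.
  by apply: le_trans (rip_le _ _) _; rewrite ler_wpM2r.
have h3 : rip (T d) d <= K * nrm d * 1.
  apply: le_trans (rip_le _ _) _; apply: (@le_trans _ _ (K * nrm d * nrm d)).
    by rewrite ler_wpM2r.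
  by rewrite ler_wpM2l ?mulr_ge0// ltW.
move: dC; rewrite /C; lra.
Qed.

(** Lyapunov's theorem for the sign of the form of J on Ran P.  If its infimum c
   were negative, then P J would act on an approximate minimiser z almost as
   multiplication by c, and Re <T z, J z> would be close to c <T z, z>, which is
   positive and bounded away from 0. *)
Lemma lyapunov_nonnegative (T J P : {linear H -> H}) e :
  bounded_operator T -> bounded_operator J ->
  self_adjoint J -> orthogonal_projection P ->
  (forall x, T (P x) = P (T x)) ->
  (forall x, rip (T x) (J x) <= 0) -> 0 < e ->
  (forall x, rip (T (P x)) (P x) <= - e * nrm (P x) ^+ 2) ->
  forall x, 0 <= rip (J (P x)) (P x).
Proof.
move=> /bounded_operatorP[K K0 bT] /bounded_operatorP[M M0 bJ] sJ [sP PP].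
move=> TP hTJ e0 hT x.
rewrite leNgt; apply/negP => lt0.
have Prip u v : rip (P u) v = rip u (P v) by rewrite (self_adjoint_rip _ _ sP).
have Pn u : nrm (P u) <= nrm u.
  have [->|n0] := eqVneq (nrm (P u)) 0; first exact: nrm_ge0.
  have np : 0 < nrm (P u) by rewrite lt_neqAle eq_sym n0 nrm_ge0.
  by rewrite -(ler_pM2r np) -expr2 -rip_self Prip PP rip_le.
have x0 : x != 0 by apply: contraTneq lt0 => ->; rewrite linear0 rip0r ltxx.
have [C CE] : exists C : {linear H -> H}, forall x, C x = P (J (P x)).
  by apply: ex_linear => a u v; rewrite !linearP.
have bC : bounded_operator C.
  apply/bounded_operatorP; exists M => // u; rewrite CE; apply: le_trans (Pn _) _.
  by apply: le_trans (bJ _) _; rewrite ler_wpM2l.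
have sC : self_adjoint C.
  apply: rip_self_adjoint; first exact: linearP.
  by move=> u v; rewrite !CE !Prip (self_adjoint_rip _ _ sJ) Prip.
have [c [cC hc]] := approximate_minimiser bC sC x0.
have Crip u : rip (C u) u = rip (J (P u)) (P u) by rewrite CE Prip.
have cn : c < 0.
  have := cC x; rewrite Crip => h; have := le_lt_trans h lt0.
  by rewrite pmulr_llt0// exprn_gt0// nrm_gt0.
(* The error r of the minimiser is chosen so small that M K |r| + a e |r| is less
   than a^2 e, whereas the Lyapunov inequality forces the opposite. *)
pose a := - c; have a0 : 0 < a by rewrite oppr_gt0.
pose L := M * K + a * e + 1.
have L0 : 0 < L by rewrite ltr_wpDl// addr_ge0// mulr_ge0// ltW.
have [y [y1 hy]] := hc _ (divr_gt0 (mulr_gt0 (exprn_gt0 2 a0) e0) L0).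
move: hy; set r := C y - _; rewrite ltr_pdivlMr// => hr.
pose z := P y; have zz : P z = z by rewrite /z PP.
have z1 : nrm z <= 1 by rewrite -y1; exact: Pn.
have n0 := nrm_ge0 r; have m0 := nrm_ge0 z.
have PJz : P (J z) = c%:C *: z + P r.
  by rewrite /r linearB linearZ /= CE PP addrC subrK.
have h1 := hTJ z; rewrite -{1}zz TP Prip PJz ripDr ripZr in h1.
have h2 : - (K * nrm r) <= rip (T z) (P r).
  apply: le_trans (rip_ge _ _); rewrite lerN2; apply: ler_pM => //; try exact: nrm_ge0.
  by apply: le_trans (bT _) _; rewrite -[leRHS]mulr1 ler_wpM2l.
have h3 := hT y; rewrite -/z in h3.
have h4 : rip (J z) z <= c + nrm r.
  rewrite -Crip -[C y](subrK (c%:C *: y)) -/r ripDl ripZl rip_self y1 expr1n mulr1.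
  by rewrite addrC lerD2l; apply: le_trans (rip_le _ _) _; rewrite y1 mulr1.
have h5 : - (M * nrm z ^+ 2) <= rip (J z) z.
  apply: le_trans (rip_ge _ _); rewrite lerN2 expr2 mulrA.
  by rewrite ler_wpM2r.
have h6 : a * (e * nrm z ^+ 2) <= K * nrm r.
  apply: (@le_trans _ _ (a * - rip (T z) z)); first by rewrite ler_pM2l// lerNr; lra.
  by move: h1 h2; rewrite /a; lra.
have h7 := ler_wpM2l M0 h6.
have h8 : a * e * (a - nrm r) <= a * e * (M * nrm z ^+ 2).
  by rewrite ler_pM2l ?mulr_gt0// /a; move: h4 h5; lra.
move: hr; rewrite /L; lra.
Qed.

End FormInequalities.

(** * The operator norm *)

Section OperatorNorm.
Context (R : realType).
Implicit Types F G : hilbertType R.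

Lemma le1_nrm F (x : F) : (`|x| <= 1) = (nrm x <= 1).
Proof. by rewrite normE -lecR. Qed.

Lemma opnorm_le F G (T : {linear F -> G}) K : 0 <= K -> bound_by T K -> opnorm T <= K.
Proof.
move=> K0 bT; apply: ge_sup.
  by exists (complex.Re `|T 0|), 0 => //=; rewrite normr0 ler01.
move=> _ [x /= x1 <-]; apply: le_trans (bT x) _.
by rewrite -[leRHS]mulr1 ler_wpM2l// -le1_nrm.
Qed.

Lemma opnorm_bound F G (T : {linear F -> G}) :
  bounded_operator T -> bound_by T (opnorm T).
Proof.
move=> /bounded_operatorP[K K0 bT] x; have [->|x0] := eqVneq x 0.
  by rewrite linear0 !nrm0 mulr0.
have xp := nrm_gt0 x0.
rewrite -ler_pdivrMr//; apply: ub_le_sup.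
  exists K => _ [y /= y1 <-]; apply: le_trans (bT y) _.
  by rewrite -[leRHS]mulr1 ler_wpM2l// -le1_nrm.
exists ((nrm x)^-1%:C *: x) => /=.
  by rewrite le1_nrm nrm_normalise.
by rewrite linearZ -/(nrm _) nrmZ gtr0_norm ?invr_gt0// mulrC.
Qed.

Lemma opnorm_ge0 F G (T : {linear F -> G}) : bounded_operator T -> 0 <= opnorm T.
Proof.
move=> /bounded_operatorP[K K0 bT]; apply: ub_le_sup.
  exists K => _ [y /= y1 <-]; apply: le_trans (bT y) _.
  by rewrite -[leRHS]mulr1 ler_wpM2l// -le1_nrm.
by exists 0 => /=; rewrite ?linear0 normr0 ?ler01.
Qed.

End OperatorNorm.

(** * The half-angle bound *)

Section HalfAngle.
Context (R : realType).

Lemma tan_half_atan (q : R) : 0 <= q ->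
  let t := tan (atan q / 2) in [/\ 0 <= t, t < 1 & q * (1 - t ^+ 2) = 2 * t].
Proof.
move=> q0 /=; set a := atan q / 2.
have at0 : 0 <= atan q by rewrite -atan0 le_atan.
have at1 : atan q < pi / 2 := atan_ltpi2 q.
have pi0 := pi_gt0 R.
have a0 : 0 <= a by rewrite /a; lra.
have a1 : a < pi / 4 by rewrite /a; lra.
have inI x : 0 <= x -> x < pi / 2 -> x \in `](- (pi / 2)), (pi / 2)[%R.
  by move=> x0 x1; rewrite in_itv/=; apply/andP; split; lra.
have aI : a \in `](- (pi / 2)), (pi / 2)[%R by apply: inI => //; lra.
have c0 : cos a != 0.
  by rewrite gt_eqF// cos_gt0_pihalf//; move: aI; rewrite in_itv.
have t0 : 0 <= tan a.
  rewrite -tan0 leNgt ltr_tan// ?inI// -?leNgt//; lra.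
have t1 : tan a < 1.
  by rewrite -tan_piquarter ltr_tan// inI//; lra.
split=> //.
have w0 : 0 < 1 - tan a ^+ 2 by rewrite subr_gt0 expr_lt1.
have := tan_mulr2n c0; rewrite -[a *+ 2]mulr_natr /a divfK ?pnatr_eq0// atanK -/a => qE.
by rewrite {1}qE divfK ?gt_eqF// mulr_natl.
Qed.

(** Both s and the half-angle tangent t are compared through the increasing
   function u |-> 2 u / (1 - u^2), the tangent of twice the arctangent of u: it is
   at most 2 v / d at s and equal to it at t. *)
Lemma le_tan_half_atan (s v d : R) : 0 < d -> 0 <= v -> 0 <= s ->
  d * s <= (1 - s ^+ 2) * v -> s <= tan (atan (2 * v / d) / 2).
Proof.
move=> d0 v0 s0 h; have q0 : 0 <= 2 * v / d by rewrite !mulr_ge0// invr_ge0 ltW.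
have [t0 t1 tE] := tan_half_atan q0; move: t0 t1 tE; set t := tan _ => t0 t1 tE.
have vE : v * (1 - t ^+ 2) = d * t.
  have : 2 * v / d * (1 - t ^+ 2) * d = 2 * t * d by rewrite tE.
  have -> : 2 * v / d * (1 - t ^+ 2) * d = 2 * v * (1 - t ^+ 2) by field; rewrite gt_eqF.
  lra.
have w0 : 0 < 1 - t ^+ 2 by rewrite subr_gt0 expr_lt1.
have : d * s * (1 - t ^+ 2) <= d * ((1 - s ^+ 2) * t).
  apply: (@le_trans _ _ ((1 - s ^+ 2) * v * (1 - t ^+ 2))).
    by rewrite ler_wpM2r// ltW.
  by rewrite -mulrA vE; lra.
rewrite -mulrA ler_pM2l// => h'.
rewrite leNgt; apply/negP => ts.
have : 0 < (s - t) * (1 + s * t) by rewrite mulr_gt0 ?subr_gt0// ltr_wpDr// mulr_ge0.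
lra.
Qed.

End HalfAngle.

(** * Operator matrices *)

Section Decomposition.
Context (R : realType) (H H0 H1 : hilbertType R).
Variables (i0 : {linear H0 -> H}) (i1 : {linear H1 -> H}).
Hypothesis hdec : orthogonal_decomposition i0 i1.
Implicit Types (z w : H) (x : H0) (y : H1).

Lemma adjoint_i0 x y : adjoint i0 (i0 x + i1 y) = x.
Proof.
apply: adjoint_rip_unique => x'.
by rewrite ripDr /rip (decomp_isom0 hdec) (decomp_ortho hdec) addr0.
Qed.

Lemma adjoint_i1 x y : adjoint i1 (i0 x + i1 y) = y.
Proof.
apply: adjoint_rip_unique => y'; rewrite ripDr ripC.
by rewrite /rip (decomp_isom1 hdec) (decomp_ortho hdec) add0r.
Qed.

Lemma decompE z : z = i0 (adjoint i0 z) + i1 (adjoint i1 z).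
Proof.
by have [x [y ->]] := decomp_total hdec z; rewrite adjoint_i0 adjoint_i1.
Qed.

Lemma decomp_eq z w : adjoint i0 z = adjoint i0 w -> adjoint i1 z = adjoint i1 w -> z = w.
Proof. by move=> h0 h1; rewrite (decompE z) h0 h1 -decompE. Qed.

Lemma adjoint_i0_linear : linear (adjoint i0).
Proof.
move=> a z w; rewrite {1}(decompE z) {1}(decompE w) scalerDr addrACA.
by rewrite -!linearP adjoint_i0.
Qed.

Lemma adjoint_i1_linear : linear (adjoint i1).
Proof.
move=> a z w; rewrite {1}(decompE z) {1}(decompE w) scalerDr addrACA.
by rewrite -!linearP adjoint_i1.
Qed.

Lemma adjoint_i0_0 : adjoint i0 0 = 0.
Proof. by have := adjoint_i0 0 0; rewrite !linear0 addr0. Qed.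

Lemma adjoint_i1_0 : adjoint i1 0 = 0.
Proof. by have := adjoint_i1 0 0; rewrite !linear0 addr0. Qed.

Lemma adjoint_i0Z a z : adjoint i0 (a *: z) = a *: adjoint i0 z.
Proof. by rewrite -[a *: z]addr0 adjoint_i0_linear adjoint_i0_0 addr0. Qed.

Lemma adjoint_i1Z a z : adjoint i1 (a *: z) = a *: adjoint i1 z.
Proof. by rewrite -[a *: z]addr0 adjoint_i1_linear adjoint_i1_0 addr0. Qed.

Lemma rip_i0 x x' : rip (i0 x) (i0 x') = rip x x'.
Proof. by rewrite /rip (decomp_isom0 hdec). Qed.

Lemma rip_i1 y y' : rip (i1 y) (i1 y') = rip y y'.
Proof. by rewrite /rip (decomp_isom1 hdec). Qed.

Lemma rip_i01 x y : rip (i0 x) (i1 y) = 0.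
Proof. by rewrite /rip (decomp_ortho hdec). Qed.

Lemma rip_decomp z w :
  rip z w = rip (adjoint i0 z) (adjoint i0 w) + rip (adjoint i1 z) (adjoint i1 w).
Proof.
rewrite {1}(decompE z) {1}(decompE w) !ripE rip_i0 rip_i1 rip_i01.
by rewrite (ripC (i1 _)) rip_i01; lra.
Qed.

Lemma nrm_decomp z : nrm z ^+ 2 = nrm (adjoint i0 z) ^+ 2 + nrm (adjoint i1 z) ^+ 2.
Proof. by rewrite -!rip_self rip_decomp. Qed.

Lemma nrm_sqr_le (F G : hilbertType R) (u : F) (v : G) :
  nrm u ^+ 2 <= nrm v ^+ 2 -> nrm u <= nrm v.
Proof. by rewrite ler_sqr ?nnegrE ?nrm_ge0. Qed.

Lemma adjoint_i0_bound z : nrm (adjoint i0 z) <= nrm z.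
Proof. by apply: nrm_sqr_le; rewrite (nrm_decomp z) lerDl sqr_ge0. Qed.

Lemma adjoint_i1_bound z : nrm (adjoint i1 z) <= nrm z.
Proof. by apply: nrm_sqr_le; rewrite (nrm_decomp z) lerDr sqr_ge0. Qed.

Lemma nrm_i0 x : nrm (i0 x) = nrm x.
Proof. by apply/eqP; rewrite -(eqrXn2 (ltn0Sn 1)) ?nrm_ge0// -!rip_self rip_i0. Qed.

Lemma nrm_i1 y : nrm (i1 y) = nrm y.
Proof. by apply/eqP; rewrite -(eqrXn2 (ltn0Sn 1)) ?nrm_ge0// -!rip_self rip_i1. Qed.

End Decomposition.

Section BlockOperator.
Context (R : realType) (H H0 H1 : hilbertType R).
Variables (i0 : {linear H0 -> H}) (i1 : {linear H1 -> H}).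
Hypothesis hdec : orthogonal_decomposition i0 i1.
Variables (A0 : {linear H0 -> H0}) (A1 : {linear H1 -> H1}) (V : {linear H1 -> H0}).
Hypotheses (hA0 : bounded_operator A0) (hA1 : bounded_operator A1).
Hypotheses (hV : bounded_operator V).
Hypotheses (sA0 : self_adjoint A0) (sA1 : self_adjoint A1).
Implicit Types (z w : H) (x : H0) (y : H1).

Local Notation p0 := (adjoint i0).
Local Notation p1 := (adjoint i1).
Local Notation Vs := (adjoint V).
Let B := block_operator i0 i1 A0 A1 V.
Let p0K := adjoint_i0 hdec.
Let p1K := adjoint_i1 hdec.

Lemma block_p0 z : p0 (B z) = A0 (p0 z) + V (p1 z).
Proof. exact: p0K. Qed.

Lemma block_p1 z : p1 (B z) = Vs (p0 z) + A1 (p1 z).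
Proof. exact: p1K. Qed.

Lemma block_linear : linear B.
Proof.
move=> a z w; apply: (decomp_eq hdec).
- rewrite block_p0 (adjoint_i0_linear hdec) (adjoint_i1_linear hdec) !linearP.
  by rewrite (adjoint_i0_linear hdec) !block_p0 scalerDr addrACA.
- rewrite block_p1 (adjoint_i0_linear hdec) (adjoint_i1_linear hdec).
  rewrite (adjoint_linear hV) linearP.
  by rewrite (adjoint_i1_linear hdec) !block_p1 scalerDr addrACA.
Qed.

Lemma block_rip_sym z w : rip (B z) w = rip z (B w).
Proof.
rewrite !(rip_decomp hdec) !block_p0 !block_p1 !ripE.
rewrite (self_adjoint_rip _ _ sA0) (self_adjoint_rip _ _ sA1).
rewrite (adjointP hV) (ripC (Vs _) (p1 w)) (ripC (p0 z) (V _)).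
by rewrite (adjointP hV (p1 w)); lra.
Qed.

Lemma block_self_adjoint : self_adjoint B.
Proof. by apply: rip_self_adjoint; [exact: block_linear|exact: block_rip_sym]. Qed.

Lemma block_bound : exists2 K, 0 <= K & bound_by B K.
Proof.
have [K0 K00 b0] := (bounded_operatorP A0).1 hA0.
have [K1 K10 b1] := (bounded_operatorP A1).1 hA1.
have [Kv Kv0 bv] := (bounded_operatorP V).1 hV.
have bs := adjoint_bound Kv0 bv hV.
exists (K0 + Kv + (Kv + K1)); first by rewrite !addr_ge0.
move=> z; rewrite (decompE hdec (B z)).
apply: le_trans (nrmD _ _) _.
rewrite (nrm_i0 hdec) (nrm_i1 hdec) block_p0 block_p1 [leRHS]mulrDl.
apply: lerD; apply: le_trans (nrmD _ _) _; rewrite [leRHS]mulrDl; apply: lerD.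
- by apply: le_trans (b0 _) _; rewrite ler_wpM2l// (adjoint_i0_bound hdec).
- by apply: le_trans (bv _) _; rewrite ler_wpM2l// (adjoint_i1_bound hdec).
- by apply: le_trans (bs _) _; rewrite ler_wpM2l// (adjoint_i0_bound hdec).
- by apply: le_trans (b1 _) _; rewrite ler_wpM2l// (adjoint_i1_bound hdec).
Qed.

Variable lam : R.
Hypothesis A0_le : forall x, rip (A0 x) x <= lam * nrm x ^+ 2.
Hypothesis A1_ge : forall y, lam * nrm y ^+ 2 <= rip (A1 y) y.

(** With w = x + y, pairing B w = lam w with x and with y shows that Re <V y, x> is
   both nonnegative and nonpositive.  So the forms of A0 - lam at x and of A1 - lam
   at y vanish: x and y are eigenvectors, and V y and V* x must be 0. *)
Lemma block_eigenvector w : B w = lam%:C *: w ->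
  [/\ A0 (p0 w) = lam%:C *: p0 w, V (p1 w) = 0, Vs (p0 w) = 0 &
      A1 (p1 w) = lam%:C *: p1 w].
Proof.
move=> Bw; have e0 := block_p0 w; have e1 := block_p1 w.
rewrite Bw (adjoint_i0Z hdec) in e0; rewrite Bw (adjoint_i1Z hdec) in e1.
have h0 := congr1 (fun u => rip u (p0 w)) e0.
have h1 := congr1 (fun u => rip u (p1 w)) e1.
rewrite /= !ripE (adjointP hV) (ripC (p1 w)) rip_self in h0.
rewrite /= !ripE rip_self in h1.
have a0 := A0_le (p0 w); have a1 := A1_ge (p1 w).
have f0 : A0 (p0 w) = lam%:C *: p0 w by apply: eigenvector_form_max => //; lra.
have f1 : A1 (p1 w) = lam%:C *: p1 w by apply: eigenvector_form_min => //; lra.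
split=> //.
- by move: e0; rewrite f0 -{1}[_ *: _]addr0 => /addrI.
- by move: e1; rewrite f1 -{1}[_ *: _]add0r => /addIr.
Qed.

Lemma block_eigenvector_intro x y : A0 x = lam%:C *: x -> V y = 0 -> Vs x = 0 ->
  A1 y = lam%:C *: y -> B (i0 x + i1 y) = lam%:C *: (i0 x + i1 y).
Proof.
move=> e0 e1 e2 e3; rewrite (decompE hdec (B _)) block_p0 block_p1 p0K p1K.
by rewrite e0 e1 e2 e3 addr0 add0r !linearZ scalerDr.
Qed.

End BlockOperator.

(** * The spectral subspace below lambda *)

Section SpectralSubspace.
Context (R : realType) (H H0 H1 : hilbertType R).
Variables (i0 : {linear H0 -> H}) (i1 : {linear H1 -> H}).
Hypothesis hdec : orthogonal_decomposition i0 i1.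
Variables (A0 : {linear H0 -> H0}) (A1 : {linear H1 -> H1}) (V : {linear H1 -> H0}).
Hypotheses (hA0 : bounded_operator A0) (hA1 : bounded_operator A1).
Hypotheses (hV : bounded_operator V).
Hypotheses (sA0 : self_adjoint A0) (sA1 : self_adjoint A1).
Variable lam : R.
Hypothesis A0_le : forall x, rip (A0 x) x <= lam * nrm x ^+ 2.
Hypothesis A1_ge : forall y, lam * nrm y ^+ 2 <= rip (A1 y) y.
Variable E : set R -> {linear H -> H}.
Hypothesis hE : is_spectral_measure (block_operator i0 i1 A0 A1 V) E.
Implicit Types (z w : H) (x : H0) (y : H1).

Local Notation p0 := (adjoint i0).
Local Notation p1 := (adjoint i1).
Local Notation Vs := (adjoint V).
Local Notation B := (block_operator i0 i1 A0 A1 V).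
Local Notation below := (E `]-oo, lam[%classic).
Local Notation atom := (E [set lam]).
Local Notation above := (E `]lam, +oo[%classic).

Let linB : linear B := block_linear hdec A0 A1 hV.
Let symB z w : rip (B z) w = rip z (B w) := block_rip_sym hdec hV sA0 sA1 z w.
Let sB : self_adjoint B := block_self_adjoint hdec hV sA0 sA1.

(** J changes the sign of the component in H1; its form at z is
   |p0 z|^2 - |p1 z|^2, so its sign compares the two components. *)
Let reflection_ex : exists J : {linear H -> H},
  [/\ forall z, J z = i0 (p0 z) - i1 (p1 z), bounded_operator J, self_adjoint J &
   forall z w, rip (J z) w = rip (p0 z) (p0 w) - rip (p1 z) (p1 w)].
Proof.
have [J JE] : exists J : {linear H -> H}, forall z, J z = i0 (p0 z) - i1 (p1 z).
  apply: ex_linear => a z w.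
  rewrite (adjoint_i0_linear hdec) (adjoint_i1_linear hdec) !linearP scalerDr.
  by rewrite addrACA.
have Jrip z w : rip (J z) w = rip (p0 z) (p0 w) - rip (p1 z) (p1 w).
  rewrite JE ripBl {1 2}(decompE hdec w) !ripE (rip_i0 hdec) (rip_i1 hdec).
  by rewrite (ripC (i1 _)) !(rip_i01 hdec); lra.
exists J; split=> //.
- apply/bounded_operatorP; exists 2 => // z; rewrite JE.
  apply: le_trans (nrmD _ _) _; rewrite nrmN (nrm_i0 hdec) (nrm_i1 hdec).
  have := adjoint_i0_bound hdec z; have := adjoint_i1_bound hdec z; lra.
- apply: rip_self_adjoint; first exact: linearP.
  by move=> z w; rewrite Jrip (ripC z) Jrip (ripC (p0 z)) (ripC (p1 z)).
Qed.

Let shift_ex : exists T : {linear H -> H},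
  [/\ forall z, T z = B z - lam%:C *: z, bounded_operator T & self_adjoint T].
Proof.
have [B' BE] := ex_linear linB; have [T TE] := ex_linear (linear_subZ B' lam).
exists T; split=> [z| |]; first by rewrite TE BE.
- have [K K0 bB] := block_bound hdec hA0 hA1 hV.
  apply/bounded_operatorP; exists (K + `|lam|); first by rewrite addr_ge0.
  move=> z; rewrite TE BE; apply: le_trans (nrmD _ _) _.
  by rewrite nrmN nrmZ mulrDl lerD2r; exact: bB.
- apply: rip_self_adjoint; first exact: linearP.
  by move=> z w; rewrite !TE !(ripBl, ripBr, ripZl, ripZr) !BE symB.
Qed.

(** (B - lam) J + J (B - lam) is twice the block diagonal operator with entries
   A0 - lam and lam - A1: the off-diagonal part of B anticommutes with J. *)
Let shift_reflection (T J : {linear H -> H}) :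
  (forall z, T z = B z - lam%:C *: z) ->
  (forall z w, rip (J z) w = rip (p0 z) (p0 w) - rip (p1 z) (p1 w)) ->
  forall z, rip (T z) (J z) = (rip (A0 (p0 z)) (p0 z) - lam * nrm (p0 z) ^+ 2)
    - (rip (A1 (p1 z)) (p1 z) - lam * nrm (p1 z) ^+ 2).
Proof.
move=> TE JE z; rewrite ripC JE TE.
have pB (F : hilbertType R) (p : H -> F) a b : linear p -> p (a - b) = p a - p b.
  by move=> lp; rewrite addrC -scaleN1r lp scaleN1r addrC.
rewrite (pB _ _ _ _ (adjoint_i0_linear hdec)) (pB _ _ _ _ (adjoint_i1_linear hdec)).
rewrite (adjoint_i0Z hdec) (adjoint_i1Z hdec) block_p0// block_p1// !ripE !rip_self.
rewrite (ripC _ (V _)) (adjointP hV) (ripC (p0 z) (A0 _)) (ripC (p1 z) (A1 _)); lra.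
Qed.

Let shift_commute (T : {linear H -> H}) : (forall z, T z = B z - lam%:C *: z) ->
  forall D z, measurable D -> T (E D z) = E D (T z).
Proof.
move=> TE D z mD; rewrite !TE linearB; congr (_ - _); last by rewrite linearZ.
exact: spectral_commute.
Qed.

(** Lyapunov's argument needs B - lam to be bounded away from 0, so it is applied
   below lam - 1 / (n + 1), and n tends to infinity. *)
Let below_contractive z : nrm (p1 (below z)) <= nrm (p0 (below z)).
Proof.
have [J [_ bJ sJ Jrip]] := reflection_ex; have [T [TE bT sT]] := shift_ex.
apply: nrm_sqr_le; rewrite -subr_ge0 -!rip_self -Jrip.
apply: (form_ge0_limit bJ (spectral_below_exhaust hE lam z)) => n.
have mF : measurable (`]-oo, lam - n.+1%:R^-1]%classic : set R) by [].
apply: (@lyapunov_nonnegative _ _ _ _ _ n.+1%:R^-1 bT bJ sJ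
  (spectral_projection hE mF)).
- by move=> w; rewrite shift_commute.
- move=> w; rewrite (shift_reflection TE Jrip).
  have := A0_le (p0 w); have := A1_ge (p1 w); lra.
- by rewrite invr_gt0 (ltr0n _ n.+1).
- move=> w; rewrite TE ripBl ripZl rip_self.
  set u := E _ w; suff : rip (B u) u <= (lam - n.+1%:R^-1) * nrm u ^+ 2.
    by move: (n.+1%:R^-1) => e; lra.
  by apply: spectral_form_le => // t; rewrite /= in_itv.
Qed.

Let above_contractive z : nrm (p0 (above z)) <= nrm (p1 (above z)).
Proof.
have [J [_ bJ sJ Jrip]] := reflection_ex; have [T [TE bT sT]] := shift_ex.
have [N [NE bN _]] := opp_operator bT sT.
have [J' [J'E bJ' sJ']] := opp_operator bJ sJ.
apply: nrm_sqr_le; rewrite -subr_ge0 -opprB -!rip_self -Jrip -ripNl -J'E.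
apply: (form_ge0_limit bJ' (spectral_above_exhaust hE lam z)) => n.
have mF : measurable (`[lam + n.+1%:R^-1, +oo[%classic : set R) by [].
apply: (@lyapunov_nonnegative _ _ _ _ _ n.+1%:R^-1 bN bJ' sJ'
  (spectral_projection hE mF)).
- by move=> w; rewrite !NE shift_commute// linearN.
- move=> w; rewrite NE J'E ripNl ripNr opprK (shift_reflection TE Jrip).
  have := A0_le (p0 w); have := A1_ge (p1 w); lra.
- by rewrite invr_gt0 (ltr0n _ n.+1).
- move=> w; rewrite NE TE ripNl ripBl ripZl rip_self.
  set u := E _ w; suff : (lam + n.+1%:R^-1) * nrm u ^+ 2 <= rip (B u) u.
    by move: (n.+1%:R^-1) => e; lra.
  by apply: spectral_form_ge => // t; rewrite /= in_itv/= andbT.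
Qed.

(** The orthogonal projections onto Q and onto its complement: by the description of
   the eigenvectors for lam, the range of E({lam}) is the sum of its intersections
   with H0 and H1, and these are added to the two sides. *)
Let projQ z := below z + i0 (p0 (atom z)).
Let projQC z := above z + i1 (p1 (atom z)).

Let atomE z : B (atom z) = lam%:C *: atom z := spectral_atom linB sB hE lam z.

Let atom_p0 z : atom (i0 (p0 (atom z))) = i0 (p0 (atom z)) /\
  B (i0 (p0 (atom z))) = lam%:C *: i0 (p0 (atom z)).
Proof.
have [e0 e1 e2 e3] := block_eigenvector hdec hA0 hA1 hV sA0 sA1 A0_le A1_ge (atomE z).
have h : B (i0 (p0 (atom z))) = lam%:C *: i0 (p0 (atom z)).
  rewrite -[i0 _]addr0 -(linear0 i1); apply: block_eigenvector_intro => //.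
    by rewrite linear0.
  by rewrite !linear0.
by split=> //; apply: (spectral_eigenvector linB sB hE).
Qed.

Let atom_p1 z : atom (i1 (p1 (atom z))) = i1 (p1 (atom z)).
Proof.
have h : i1 (p1 (atom z)) = atom z - i0 (p0 (atom z)).
  by rewrite {2}(decompE hdec (atom z)) addrAC subrr add0r.
by rewrite h linearB /= (spectral_proj hE)// (atom_p0 z).1.
Qed.

Let below_atom z : below (atom z) = 0.
Proof.
apply: (spectral_disjoint hE) => //; apply/seteqP; split=> // t [] /=.
by rewrite in_itv/= => /[swap] ->; rewrite ltxx.
Qed.

Let atom_below z : atom (below z) = 0.
Proof.
apply: (spectral_disjoint hE) => //; apply/seteqP; split=> // t [] /= ->.
by rewrite in_itv/= ltxx.
Qed.

Let above_atom z : above (atom z) = 0.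
Proof.
apply: (spectral_disjoint hE) => //; apply/seteqP; split=> // t [] /=.
by rewrite in_itv/= andbT => /[swap] ->; rewrite ltxx.
Qed.

Let below_above z : below (above z) = 0.
Proof.
apply: (spectral_disjoint hE) => //; apply/seteqP; split=> // t [] /=.
by rewrite !in_itv/= andbT => /lt_trans h /h; rewrite ltxx.
Qed.

Let projQ_split z : z = projQ z + projQC z.
Proof.
by rewrite /projQ /projQC addrACA -decompE// addrAC; exact: (spectral_trichotomy hE).
Qed.

Let projQ_linear : linear projQ.
Proof.
move=> a z w; rewrite /projQ !linearP (adjoint_i0_linear hdec) linearP scalerDr.
by rewrite addrACA.
Qed.

Let projQ_orthogonal z w : rip (projQ z) (projQC w) = 0.
Proof.
have h0 u : rip (atom u) (above w) = 0.
  by rewrite ripC (spectral_rip hE)// above_atom rip0r.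
rewrite /projQ /projQC !ripE (rip_i01 hdec) -(atom_p0 z).1 -(atom_p1 w).
rewrite h0 !(spectral_rip hE)// below_above below_atom !rip0r; lra.
Qed.

Let projQ_sym z w : rip (projQ z) w = rip z (projQ w).
Proof.
rewrite {1}(projQ_split w) {2}(projQ_split z).
rewrite (ripDr (projQ w) (projQC w)) (ripDl (projQ z) (projQC z)).
by rewrite projQ_orthogonal (ripC (projQC z)) projQ_orthogonal.
Qed.

Let Q := Qsubspace i0 E lam.

Let QsubspaceE z : Q z <-> projQ z = z.
Proof.
split=> [[u [a _ <-]] [w [[b _ <-] [x _ xE]] <-]|<-].
  rewrite /projQ !linearD /= !(spectral_proj hE)// below_atom atom_below addr0 add0r.
  by rewrite -xE -[i0 x]addr0 -(linear0 i1) adjoint_i0// linear0 addr0.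
exists (below z) => /=; first by exists z.
exists (i0 (p0 (atom z))) => //; split; last by exists (p0 (atom z)).
by exists (i0 (p0 (atom z))) => //; exact: (atom_p0 z).1.
Qed.

Let Q_projQ z : Q (projQ z).
Proof.
exists (below z) => /=; first by exists z.
exists (i0 (p0 (atom z))) => //; split; last by exists (p0 (atom z)).
by exists (i0 (p0 (atom z))) => //; exact: (atom_p0 z).1.
Qed.

Let Q_linear a z w : Q z -> Q w -> Q (a *: z + w).
Proof.
move=> /QsubspaceE hz /QsubspaceE hw; apply/QsubspaceE.
by rewrite projQ_linear hz hw.
Qed.

Lemma Q_invariant z : Q z -> Q (B z).
Proof.
move=> /QsubspaceE hz; apply/QsubspaceE; rewrite -{2}hz /projQ.
have BD a b : B (a + b) = B a + B b by rewrite -[in LHS](scale1r a) linB scale1r.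
rewrite BD (spectral_commute linB sB hE)// (atom_p0 z).2; congr (_ + _).
by rewrite -(spectral_commute linB sB hE)// atomE (adjoint_i0Z hdec) linearZ.
Qed.

Let p0D z w : p0 (z + w) = p0 z + p0 w.
Proof. by have := adjoint_i0_linear hdec 1 z w; rewrite !scale1r. Qed.

Let p1D z w : p1 (z + w) = p1 z + p1 w.
Proof. by have := adjoint_i1_linear hdec 1 z w; rewrite !scale1r. Qed.

Let p0_i0 x : p0 (i0 x) = x.
Proof. by have := adjoint_i0 hdec x 0; rewrite linear0 addr0. Qed.

Let p1_i0 x : p1 (i0 x) = 0.
Proof. by have := adjoint_i1 hdec x 0; rewrite linear0 addr0. Qed.

Let p0_i1 y : p0 (i1 y) = 0.
Proof. by have := adjoint_i0 hdec 0 y; rewrite linear0 add0r. Qed.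

Let p1_i1 y : p1 (i1 y) = y.
Proof. by have := adjoint_i1 hdec 0 y; rewrite linear0 add0r. Qed.

(** The summand of Q inside H0 is orthogonal to the other one, and this remains
   true for the components in H0, so that it can only enlarge p0 z. *)
Lemma Q_contractive z : Q z -> nrm (p1 z) <= nrm (p0 z).
Proof.
move=> /QsubspaceE <-; apply: nrm_sqr_le.
rewrite /projQ p0D p1D p0_i0 p1_i0 addr0 nrmD_sqr.
have -> : rip (p0 (below z)) (p0 (atom z)) = 0.
  have := rip_decomp hdec (below z) (i0 (p0 (atom z))).
  rewrite p0_i0 p1_i0 rip0r addr0 => <-.
  by rewrite -(atom_p0 z).1 (spectral_rip hE)// below_atom rip0r.
have := below_contractive z; rewrite -ler_sqr ?nnegrE ?nrm_ge0//.
have := sqr_ge0 (nrm (p0 (atom z))); lra.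
Qed.

Let QC_expansive z : nrm (p0 (projQC z)) <= nrm (p1 (projQC z)).
Proof.
apply: nrm_sqr_le; rewrite /projQC p0D p1D p0_i1 p1_i1 addr0 nrmD_sqr.
have -> : rip (p1 (above z)) (p1 (atom z)) = 0.
  have := rip_decomp hdec (above z) (i1 (p1 (atom z))).
  rewrite p0_i1 p1_i1 rip0r add0r => <-.
  by rewrite -(atom_p1 z) (spectral_rip hE)// above_atom rip0r.
have := above_contractive z; rewrite -ler_sqr ?nnegrE ?nrm_ge0//.
have := sqr_ge0 (nrm (p1 (atom z))); lra.
Qed.

(** For x in H0, write x = u + v along Q and its complement.  The components of u
   and v in H1 cancel, so |u| is at least |v|: in u the component in H0 is the
   larger one, in v the one in H1. *)
Let projQ_half x : 2^-1 * nrm x ^+ 2 <= nrm (projQ (i0 x)) ^+ 2.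
Proof.
set u := projQ _; set v := projQC (i0 x).
have uv : i0 x = u + v by exact: projQ_split.
have xE : nrm x ^+ 2 = nrm u ^+ 2 + nrm v ^+ 2.
  by rewrite -(nrm_i0 hdec) uv nrmD_sqr projQ_orthogonal; lra.
have q1 : nrm (p1 u) <= nrm (p0 u) by apply: Q_contractive; exact: Q_projQ.
have q2 : nrm (p0 v) <= nrm (p1 v) by exact: QC_expansive.
have q3 : nrm (p1 v) = nrm (p1 u).
  have /eqP := p1_i0 x; rewrite uv p1D addrC addr_eq0 => /eqP ->; exact: nrmN.
have h : nrm (p0 v) ^+ 2 <= nrm (p0 u) ^+ 2.
  by rewrite ler_sqr ?nnegrE ?nrm_ge0// (le_trans q2)// q3.
have := nrm_decomp hdec u; have := nrm_decomp hdec v; rewrite q3; lra.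
Qed.

(** The compression to H0 of the projection onto Q is bounded below by 1/2,
   hence onto, so that H0 is covered by the projection of Q. *)
Let Q_onto x : exists y, Q (i0 x + i1 y).
Proof.
have p0_rip h z : rip (p0 z) h = rip z (i0 h).
  by rewrite (rip_decomp hdec) p0_i0 p1_i0 rip0r addr0.
have [D DE] : exists D : {linear H0 -> H0}, forall h, D h = p0 (projQ (i0 h)).
  by apply: ex_linear => a u v; rewrite linearP projQ_linear (adjoint_i0_linear hdec).
have sD : self_adjoint D.
  apply: rip_self_adjoint; first exact: linearP.
  by move=> u v; rewrite !DE p0_rip projQ_sym (ripC u) p0_rip ripC.
have cD h : 2^-1 * nrm h ^+ 2 <= rip (D h) h.
  rewrite DE p0_rip {2}(projQ_split (i0 h)) (ripDr (projQ (i0 h))).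
  rewrite projQ_orthogonal addr0 rip_self; exact: projQ_half.
have h2 : 0 < 2^-1 :> R by rewrite invr_gt0.
have [g hg] : exists g, forall v, rip (D g) v = rip x v.
  apply: (@coercive_representation _ _ D (rip x) (nrm x) _ sD h2 cD).
  - by move=> u v; rewrite ripDr.
  - by move=> a u; rewrite ripZr.
  - by move=> u; exact: cauchy_schwarz.
exists (p1 (projQ (i0 g))).
by rewrite -(rip_eq hg) DE -decompE//; exact: Q_projQ.
Qed.

Lemma Q_graph : exists X : {linear H0 -> H1},
  forall x y, Q (i0 x + i1 y) <-> y = X x.
Proof.
have Q0 y : Q (i1 y) -> y = 0.
  move=> /Q_contractive; rewrite p1_i1 p0_i1 nrm0 => h.
  by apply/nrm0_eq0/eqP; rewrite eq_le h nrm_ge0.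
have uniq x y y' : Q (i0 x + i1 y) -> Q (i0 x + i1 y') -> y = y'.
  move=> h h'; have := Q_linear (-1) h h'.
  rewrite scaleN1r opprD addrACA addNr add0r -linearN -linearD => /Q0 /eqP.
  by rewrite addrC subr_eq0 => /eqP.
have [f hf] := choice Q_onto.
have [X XE] : exists X : {linear H0 -> H1}, forall x, X x = f x.
  apply: ex_linear => a u v; apply: (uniq (a *: u + v)) => //.
  by rewrite !linearP addrACA -scalerDr; exact: Q_linear.
exists X => x y; rewrite XE; split=> [h|->//].
exact: (uniq x).
Qed.

Lemma Q_eigenvector x : B (i0 x) = lam%:C *: i0 x -> Q (i0 x).
Proof.
move=> /(spectral_eigenvector linB sB hE) h; exists 0.
  by exists 0; rewrite ?linear0.
by exists (i0 x); rewrite ?add0r//; split; [exists (i0 x)|exists x].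
Qed.

Lemma Q_ortho_eigenvector y z : B (i1 y) = lam%:C *: i1 y -> Q z -> rip (p1 z) y = 0.
Proof.
move=> /(spectral_eigenvector linB sB hE) h /QsubspaceE <-.
rewrite /projQ p1D p1_i0 addr0.
have := rip_decomp hdec (below z) (i1 y); rewrite p0_i1 p1_i1 rip0r add0r => <-.
by rewrite -h (spectral_rip hE)// below_atom rip0r.
Qed.

(** Equality of the norms means that z is isotropic for the nonnegative form of J
   on Q, hence that J z is orthogonal to Q and in particular to (B - lam) z; the
   Lyapunov identity then forces both components to be eigenvectors. *)
Lemma Q_isotropic z : Q z -> nrm (p1 z) = nrm (p0 z) ->
  A0 (p0 z) = lam%:C *: p0 z /\ A1 (p1 z) = lam%:C *: p1 z.
Proof.
move=> Qz zz; have /QsubspaceE pz := Qz.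
have [J [_ bJ sJ Jrip]] := reflection_ex; have [T [TE bT sT]] := shift_ex.
have [C CE] : exists C : {linear H -> H}, forall w, C w = projQ (J (projQ w)).
  by apply: ex_linear => a u v; rewrite projQ_linear linearP projQ_linear.
have sC : self_adjoint C.
  apply: rip_self_adjoint; first exact: linearP.
  by move=> u v; rewrite !CE projQ_sym (self_adjoint_rip _ _ sJ) projQ_sym.
have Crip w : rip (C w) w = nrm (p0 (projQ w)) ^+ 2 - nrm (p1 (projQ w)) ^+ 2.
  by rewrite CE projQ_sym Jrip !rip_self.
have projQ_le w : nrm (projQ w) <= nrm w.
  apply: nrm_sqr_le; rewrite {2}(projQ_split w) (nrmD_sqr (projQ w)) projQ_orthogonal.
  by have := sqr_ge0 (nrm (projQC w)); lra.
have bC : bounded_operator C.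
  move/bounded_operatorP: bJ => [K K0 bJ]; apply/bounded_operatorP; exists K => // w.
  rewrite CE (le_trans (projQ_le _))// (le_trans (bJ _))// ler_wpM2l//.
have Cz : C z = 0%:C *: z.
  apply: eigenvector_form_min => // [w|]; rewrite Crip ?mul0r.
    by rewrite subr_ge0 ler_sqr ?nnegrE ?nrm_ge0// Q_contractive//; exact: Q_projQ.
  by rewrite pz zz subrr.
have QT : projQ (T z) = T z.
  apply/QsubspaceE; rewrite TE -scaleNr addrC; apply: Q_linear => //.
  exact: Q_invariant.
have := shift_reflection TE Jrip z.
have Jz : projQ (J z) = 0 by move: Cz; rewrite CE pz scale0r.
rewrite -QT projQ_sym Jz rip0r => h.
have a0 := A0_le (p0 z); have a1 := A1_ge (p1 z).
by split; [apply: eigenvector_form_max|apply: eigenvector_form_min] => //; lra.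
Qed.

End SpectralSubspace.

(** * The norm of the angular operator *)

Section Riccati.
Context (R : realType) (H0 H1 : hilbertType R).
Variables (A0 : {linear H0 -> H0}) (A1 : {linear H1 -> H1}) (V : {linear H1 -> H0}).
Hypotheses (hA0 : bounded_operator A0) (hV : bounded_operator V).
Variable X : {linear H0 -> H1}.
Hypothesis X_contraction : forall x, nrm (X x) <= nrm x.
Hypothesis riccati : forall x, adjoint V x + A1 (X x) = X (A0 x + V (X x)).
Variables (a b : R).
Hypothesis A0_le : forall x, rip (A0 x) x <= a * nrm x ^+ 2.
Hypothesis A1_ge : forall y, b * nrm y ^+ 2 <= rip (A1 y) y.

(** The Riccati equation is paired with X x at an approximate maximiser x of
   |X x|: there X* X x is almost s^2 x with s the norm of X. *)
Lemma riccati_norm (x0 : H0) : x0 != 0 -> exists s : R,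
  [/\ 0 <= s, s <= 1, bound_by X s & (b - a) * s ^+ 2 <= (1 - s ^+ 2) * opnorm V * s].
Proof.
move=> x00.
have c1 : bound_by X 1 by move=> x; rewrite mul1r.
have bX : bounded_operator X by apply/bounded_operatorP; exists 1.
have c1' : bound_by (adjoint X) 1 := adjoint_bound ler01 c1 bX.
have [K0 K00 bA0] := (bounded_operatorP A0).1 hA0.
have v0 := opnorm_ge0 hV; have bV := opnorm_bound hV; set v := opnorm V in v0 bV *.
have [C CE] : exists C : {linear H0 -> H0}, forall x, C x = - adjoint X (X x).
  by apply: ex_linear => t x y; rewrite linearP (adjoint_linear bX) opprD scalerN.
have Crip x y : rip (C x) y = - rip (X x) (X y).
  by rewrite CE ripNl ripC -(adjointP bX) ripC.
have bC : bounded_operator C.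
  apply/bounded_operatorP; exists 1 => // x; rewrite CE nrmN.
  by apply: le_trans (c1' _) _; rewrite mul1r; exact: c1.
have sC : self_adjoint C.
  apply: rip_self_adjoint; first exact: linearP.
  by move=> x y; rewrite Crip (ripC x) Crip ripC.
have [c [cC hc]] := approximate_minimiser bC sC x00.
pose m := - c.
have Xm x : nrm (X x) ^+ 2 <= m * nrm x ^+ 2.
  by have := cC x; rewrite Crip rip_self /m; lra.
have m0 : 0 <= m.
  have [x [x1 _]] := hc 1 ltr01; have := Xm x; rewrite x1 expr1n mulr1.
  exact: le_trans (sqr_ge0 _).
pose s := Num.sqrt m; have s0 : 0 <= s by exact: sqrtr_ge0.
have sm : s ^+ 2 = m by rewrite sqr_sqrtr.
have Xs : bound_by X s.
  move=> x; rewrite -ler_sqr ?nnegrE ?nrm_ge0 ?mulr_ge0 ?nrm_ge0//.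
  by rewrite exprMn sm.
(* The pairing at a unit vector x, with e bounding X* X x - m x. *)
have pairing e : 0 < e -> m <= 1 + e /\
    exists q, `|q| <= v * s /\ (b - a) * m <= (m - 1) * q + (K0 + v + `|b|) * e.
  move=> e0; have [x [x1 hx]] := hc _ e0.
  pose r := adjoint X (X x) - m%:C *: x.
  have re : nrm r < e.
    by rewrite -nrmN /r opprB addrC /m rmorphN /= scaleNr -CE.
  have e1 : nrm r <= e := ltW re.
  have XX : adjoint X (X x) = m%:C *: x + r by rewrite /r addrC subrK.
  have Xx1 : nrm (X x) <= 1 by rewrite -x1.
  have nE : nrm (X x) ^+ 2 = m + rip x r.
    by rewrite -rip_self (adjointP bX) XX ripDr ripZr rip_self x1 expr1n mulr1.
  have hxr : `|rip x r| <= e.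
    by apply: le_trans (cauchy_schwarz _ _) _; rewrite x1 mul1r.
  have n1 : nrm (X x) ^+ 2 <= 1 by rewrite expr_le1 ?nrm_ge0.
  split; first by move: hxr; rewrite ler_norml => /andP[]; lra.
  exists (rip (V (X x)) x); split.
    apply: le_trans (cauchy_schwarz _ _) _; rewrite x1 mulr1.
    apply: le_trans (bV _) _; rewrite ler_wpM2l//.
    by have := Xs x; rewrite x1 mulr1.
  have := congr1 (fun y => rip y (X x)) (riccati x); rewrite /= (ripDl (adjoint V x)).
  rewrite (adjointP bX) XX (ripDr (m%:C *: x)) ripZr ripDl.
  rewrite (ripC (adjoint V x)) -(adjointP hV) => ric.
  have h1 := A1_ge (X x); rewrite nE in h1.
  have h2 : - (`|b| * e) <= b * rip x r.
    by apply: lerNnormlW; rewrite normrM ler_wpM2l.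
  have h3 : rip (A0 x + V (X x)) r <= (K0 + v) * e.
    apply: le_trans (rip_le _ _) _; apply: ler_pM => //; try exact: nrm_ge0.
    apply: le_trans (nrmD _ _) _; apply: lerD.
      by have := bA0 x; rewrite x1 mulr1.
    by apply: le_trans (bV _) _; rewrite -[leRHS]mulr1 ler_wpM2l.
  have h4 := ler_wpM2l m0 (A0_le x); rewrite x1 expr1n mulr1 in h4.
  lra.
have m1 : m <= 1.
  by apply/ler_addgt0Pr => e /pairing[].
exists s; split=> //.
  by rewrite -ler_sqr ?nnegrE// sm expr1n.
rewrite sm; apply/ler_addgt0Pr => e e0.
have L0 : 0 < K0 + v + `|b| + 1 by rewrite ltr_wpDl// !addr_ge0.
have [_ [q [hq]]] := pairing _ (divr_gt0 e0 L0).
have : (K0 + v + `|b|) * (e / (K0 + v + `|b| + 1)) <= e.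
  rewrite mulrA ler_pdivrMr// mulrC ler_pM2l// lerDl//.
have : (m - 1) * q <= (1 - m) * (v * s).
  rewrite -opprB mulNr -mulrN ler_wpM2l ?subr_ge0//.
  by apply: le_trans hq; rewrite -normrN ler_norm.
lra.
Qed.

End Riccati.

(** * The invariant graph subspace of an operator matrix *)

Theorem theorem2p4 (R : realType) (H H0 H1 : hilbertType R)
  (i0 : {linear H0 -> H}) (i1 : {linear H1 -> H})
  (hsep : separable H)
  (hdec : orthogonal_decomposition i0 i1)
  (A0 : {linear H0 -> H0}) (A1 : {linear H1 -> H1}) (V : {linear H1 -> H0})
  (hA0 : bounded_operator A0) (hA1 : bounded_operator A1)
  (hV : bounded_operator V)
  (sA0 : self_adjoint A0) (sA1 : self_adjoint A1)
  (lam : R)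
  (hlam0 : (sup_spectrum A0 <= lam%:E)%E)
  (hlam1 : (lam%:E <= inf_spectrum A1)%E)
  (E : set R -> {linear H -> H})
  (hE : is_spectral_measure (block_operator i0 i1 A0 A1 V) E) :
  let B := block_operator i0 i1 A0 A1 V in
  let Q := Qsubspace i0 E lam in
  let K0 := kernel_set (shift_operator A0 lam%:C) in
  let K1 := kernel_set (shift_operator A1 lam%:C) in
  (forall z, Q z -> Q (B z)) /\
  exists X : {linear H0 -> H1},
    [/\ (* (i) *)
        [/\ bounded_operator X,
            Q = graph_subspace i0 i1 X,
            opnorm X <= 1,
            K0 `&` kernel_set (adjoint V) `<=` kernel_set X &
            K1 `&` kernel_set V `<=` kernel_set (adjoint X)],
        (* (ii) *)
        K0 = [set 0] \/ K1 = [set 0] ->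
          forall f : H0, f != 0 -> `|X f| < `|f| &
        (* (iii): d = +oo only if H0 or H1 is zero, and then V = 0 *)
        let d := set_dist (real_spectrum A0) (real_spectrum A1) in
        (0 < d)%E ->
          opnorm X <= tan (atan (2 * opnorm V / fine d) / 2) /\
          tan (atan (2 * opnorm V / fine d) / 2) < 1].
Proof.
move=> B Q K0 K1.
have A0_le := sup_spectrum_le hA0 sA0 hlam0.
have A1_ge := le_inf_spectrum hA1 sA1 hlam1.
split=> [z|]; first exact: Q_invariant.
have [X XE] := Q_graph hdec hA0 hA1 hV sA0 sA1 A0_le A1_ge hE.
have QX x : Q (i0 x + i1 (X x)) by apply/XE.
have Xc x : nrm (X x) <= nrm x.
  have := Q_contractive hdec hA0 hA1 hV sA0 sA1 A0_le A1_ge hE (QX x).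
  by rewrite adjoint_i0// adjoint_i1.
have c1 : bound_by X 1 by move=> x; rewrite mul1r.
have bX : bounded_operator X by apply/bounded_operatorP; exists 1.
have K0E x : K0 x -> A0 x = lam%:C *: x by move/eqP; rewrite subr_eq0 => /eqP.
have K1E y : K1 y -> A1 y = lam%:C *: y by move/eqP; rewrite subr_eq0 => /eqP.
exists X; split.
- split=> //.
  + apply/seteqP; split=> [z Qz|_ [x _ <-]]; last exact: QX.
    exists (adjoint i0 z) => //; rewrite [RHS](decompE hdec); congr (_ + i1 _).
    by apply/esym/XE; rewrite -decompE.
  + exact: opnorm_le.
  + move=> x [/K0E x0 x1]; apply/esym/XE; rewrite linear0 addr0.
    apply: (Q_eigenvector hdec hV sA0 sA1 hE); rewrite -[i0 x]addr0 -(linear0 i1).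
    by apply: block_eigenvector_intro => //; rewrite ?linear0 ?scaler0.
  + move=> y [/K1E y0 y1]; apply: adjoint_rip_unique => x; rewrite rip0r.
    rewrite -[X x](adjoint_i1 hdec x).
    apply: (Q_ortho_eigenvector hdec hA0 hA1 hV sA0 sA1 A0_le A1_ge hE) (QX x).
    rewrite -[i1 y]add0r -(linear0 i0).
    apply: block_eigenvector_intro => //; rewrite ?linear0//.
    by apply: adjoint_rip_unique => x'; rewrite !rip0r.
- move=> hK f f0; rewrite !normE ltcR lt_neqAle Xc andbT; apply/eqP => fX.
  have := Q_isotropic hdec hA0 hA1 hV sA0 sA1 A0_le A1_ge hE (QX f).
  rewrite adjoint_i0// adjoint_i1// => /(_ fX)[e0 e1].
  have k0 : K0 f by apply/eqP; rewrite subr_eq0; apply/eqP.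
  have k1 : K1 (X f) by apply/eqP; rewrite subr_eq0; apply/eqP.
  case: hK => hK; first by move: k0 f0; rewrite hK /= => ->; rewrite eqxx.
  move: k1 fX f0; rewrite hK /= => ->; rewrite nrm0 => /esym/nrm0_eq0 ->.
  by rewrite eqxx.
- move=> d d0.
  have tan1 : 0 <= 2 * opnorm V / fine d.
    by rewrite divr_ge0 ?mulr_ge0 ?opnorm_ge0// fine_ge0// ltW.
  have [t0 t1 _] := tan_half_atan tan1; split=> //.
  (* If one of the summands is zero then so is X, and the spectra do not provide
     numbers a and b. *)
  have [[x0 x00]|/forallNP x0] := pselect (exists x : H0, x != 0); last first.
    apply: (@le_trans _ _ 0) t0; apply: opnorm_le => // x.
    by move/negP/negPn/eqP: (x0 x) => ->; rewrite linear0 !nrm0 mulr0.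
  have [[y0 y00]|/forallNP y0] := pselect (exists y : H1, y != 0); last first.
    apply: (@le_trans _ _ 0) t0; apply: opnorm_le => // x.
    by move/negP/negPn/eqP: (y0 (X x)) => ->; rewrite nrm0 mul0r.
  have [a Aa A0a] := upper_bound_in_spectrum hA0 sA0 x00.
  have [b Ab A1b] := lower_bound_in_spectrum hA1 sA1 y00.
  have al : a <= lam.
    by rewrite -lee_fin; apply: le_trans hlam0; apply: ereal_sup_ubound; exists a.
  have lb : lam <= b.
    by rewrite -lee_fin; apply: le_trans hlam1 _; apply: ereal_inf_lbound; exists b.
  have dab : (d <= (b - a)%:E)%E.
    apply: (@le_trans _ _ (`|a - b|%:E)%E).
      by apply: ereal_inf_lbound; exists a => //; exists b.
    by rewrite lee_fin distrC ger0_norm// subr_ge0 (le_trans al).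
  have dfin : d \is a fin_num.
    by rewrite fin_numE gt_eqF ?(lt_trans (ltNyr 0))// lt_eqF ?(le_lt_trans dab)// ltry.
  have fd0 : 0 < fine d by rewrite fine_gt0// d0 ltey_eq dfin.
  have fdab : fine d <= b - a by rewrite -lee_fin fineK.
  have riccati x : adjoint V x + A1 (X x) = X (A0 x + V (X x)).
    have := Q_invariant hdec hA0 hA1 hV sA0 sA1 A0_le A1_ge hE (QX x).
    rewrite [block_operator _ _ _ _ _ _](decompE hdec) => /XE.
    by rewrite block_p0// block_p1// adjoint_i0// adjoint_i1.
  (* The pairing only gives the bound multiplied by s. *)
  have [s [s0 s1 Xs hs]] := riccati_norm hA0 hV Xc riccati A0a A1b x00.
  apply: le_trans (opnorm_le s0 Xs) _.
  apply: le_tan_half_atan => //; first exact: opnorm_ge0.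
  have [->|sn] := eqVneq s 0.
    by rewrite mulr0 expr0n subr0 mul1r opnorm_ge0.
  have sp : 0 < s by rewrite lt_neqAle eq_sym sn.
  rewrite -(ler_pM2r sp); apply: le_trans hs.
  by rewrite -mulrA -expr2 ler_wpM2r ?sqr_ge0.
Qed.
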